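(* Let $k\in \mathbb{N}$ with $k\ge4$ be fixed and let $n\in k\mathbb{N}$. With high probability $G(n,p)$ has the property that for every graph $G$ on the same vertex set with $\delta(G)\ge \eta n$, the graph $G\cup G(n,p)$ contains an $F$-factor, in each of the following cases: (1) $F=T_k$ for some $k$-vertex tree $T_k$, $\eta>0$ and $p\ge Cn^{-1}$ for some constant $C=C(\eta)$; (2) $F=C_k$ is the $k$-vertex cycle, $\eta>\tfrac{1}{k}$ and $p\ge Cn^{-1}$ for some constant $C=C(\eta)$.
   Context: $G(n,p)$ is the binomial random graph on $n$ vertices with edge probability $p=p(n)$. ''With high probability'' means with probability tending to $1$ as $n\to\infty$ (here along $n\in k\mathbb{N}$), with $k$, $F$ and $\eta$ fixed; the constant $C$ may depend on $\eta$ (and the fixed $k$), and the property is that, simultaneously for all graphs $G$ on the vertex set of $G(n,p)$ with minimum degree $\delta(G)\ge\eta n$, the union contains an $F$-factor. An $F$-factor of a graph is a collection of vertex-disjoint copies of $F$ (not necessarily induced) covering all vertices. *)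

(* Defs.v *)
From HB Require Import structures.
From mathcomp Require Import all_boot all_order all_algebra.
From mathcomp Require Import all_classical all_reals all_analysis.

Set Implicit Arguments.
Unset Strict Implicit.
Unset Printing Implicit Defensive.

Import Order.TTheory GRing.Theory Num.Theory.
Import numFieldNormedType.Exports.

Local Open Scope ring_scope.
Local Open Scope classical_set_scope.

(* A finite simple graph on V, given by its edge set: a set of 2-subsets. *)
Record sgraph (V : finType) := SGraph {
  edges : {set {set V}};
  edges_card2 : [forall e in edges, #|e| == 2%N] }.

HB.instance Definition _ (V : finType) := [isSub for @edges V].
HB.instance Definition _ (V : finType) := [Finite of sgraph V by <:].

Section Graphs.
Variable V : finType.
Implicit Types G H : sgraph V.

(* Loop-free, since [set x; x] is not a 2-subset. *)
Definition adj G : rel V := fun x y => [set x; y]%SET \in edges G.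

Fact gunion_card2 G H : [forall e in (edges G :|: edges H)%SET, #|e| == 2%N].
Proof.
apply/forall_inP => e; rewrite finset.in_setU => /orP[].
- exact: (forall_inP (edges_card2 G)).
- exact: (forall_inP (edges_card2 H)).
Qed.

Definition gunion G H : sgraph V := SGraph (gunion_card2 G H).

(* The graph joining distinct x and y whenever r x y or r y x. *)
Definition rel_edges (r : rel V) : {set {set V}} :=
  [set e : {set V} | (#|e| == 2%N) &&
     [exists x, exists y, r x y && (e == [set x; y])]]%SET.

Fact rel_edges_card2 (r : rel V) : [forall e in rel_edges r, #|e| == 2%N].
Proof. by apply/forall_inP => e; rewrite inE => /andP[]. Qed.

Definition graph_of_rel (r : rel V) : sgraph V := SGraph (rel_edges_card2 r).

Definition deg G (x : V) : nat := #|[set y | adj G x y]%SET|.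

(* Degrees are less than #|V|, so the default value #|V| is only reached when
   V is empty. *)
Definition min_deg G : nat := \big[minn/#|V|]_(x : V) deg G x.

Definition connected_graph G : Prop := forall x y, connect (adj G) x y.

(* ucycle also accepts the sequences [::] and [:: x; y] with x, y adjacent,
   which are not cycles of a graph. *)
Definition acyclic_graph G : Prop :=
  forall c : seq V, ucycle (adj G) c -> (size c < 3)%N.

Definition is_tree G : Prop := connected_graph G /\ acyclic_graph G.

End Graphs.

(* The cycle 0, 1, .., k-1, 0 (a genuine cycle when 3 <= k). *)
Definition cycle_graph (k : nat) : sgraph 'I_k :=
  graph_of_rel (fun i j : 'I_k => j == ordS i).

Section Factors.
Variables U V : finType.

(* f maps F onto a copy, not necessarily induced, of F in H. *)
Definition is_copy (F : sgraph U) (H : sgraph V) (f : {ffun U -> V}) : bool :=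
  injectiveb f && [forall x, forall y, adj F x y ==> adj H (f x) (f y)].

Definition has_factor (F : sgraph U) (H : sgraph V) : bool :=
  [exists S : {set {ffun U -> V}},
    [&& [forall f in S, is_copy F H f],
        [forall f in S, forall g in S,
           (f != g) ==> [disjoint codom f & codom g]]
      & [forall v, exists f in S, v \in codom f]]].

End Factors.

Section RandomGraph.
Variable R : realType.

(* Probability that G(n,p) = H: every pair of vertices is an edge
   independently with probability p. *)
Definition gnp_mass (n : nat) (p : R) (H : sgraph 'I_n) : R :=
  \prod_(e : {set 'I_n} | #|e| == 2%N) (if e \in edges H then p else 1 - p).

Definition gnp_pr (n : nat) (p : R) (A : pred (sgraph 'I_n)) : R :=
  \sum_(H : sgraph 'I_n | A H) gnp_mass p H.

Definition perturbed_factor (k n : nat) (F : sgraph 'I_k) (eta : R)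
    (H : sgraph 'I_n) : bool :=
  [forall G : sgraph 'I_n,
     (eta * n%:R <= (min_deg G)%:R) ==> has_factor F (gunion G H)].

(* The event A n holds with high probability in G(n, p n), n -> oo in k*nat. *)
Definition whp_multiples (k : nat) (p : nat -> R)
    (A : forall n, pred (sgraph 'I_n)) : Prop :=
  (fun m => gnp_pr (p (k * m)%N) (A (k * m)%N)) @ \oo --> (1 : R).

(* p n >= C / n is only required for large n: as p n <= 1, it cannot hold for
   n < C. *)
Definition prob_at_least (k : nat) (C : R) (p : nat -> R) : Prop :=
  (forall n, 0 <= p n <= 1) /\
  (\forall m \near \oo, C / (k * m)%:R <= p (k * m)%N).

End RandomGraph.

(* Main.v *)
(** Call a graph spread at scale N if any two disjoint sets of at least n / N vertices
    span a positive proportion, depending only on N, of the largest number of edges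
    between two disjoint sets. Exponential moments and a union bound over the 4^n
    pairs of sets show that G(n,p) is spread with high probability once p >= C / n.
    The rest is deterministic and applies to every G at once.

    Factors are built by absorption. A unit is a bounded set S such that S + v can be
    tiled by copies of F for all but few vertices v. It is a chain of (k-1)-sets, each
    completed to a copy of F by a constant fraction of the vertices that the earlier
    ones miss; gadgets between consecutive (k-1)-sets allow any one of them to be
    freed. Build m disjoint units, cover the few vertices that many units miss, tile
    all but exactly m of the remaining vertices, and match these m vertices with the
    units in a bipartite graph that is nearly complete.

    For cycles, the (k-1)-sets are paths of the random graph whose ends have many
    common neighbours in G, found by averaging over random edges. The condition
    eta > 1 / k serves to tile almost all vertices: if disjoint cycles leave a linear
    set L uncovered, then some cycle has two vertices with many G-neighbours in L.
    Each of them closes a random path inside L, and one cycle becomes two. *)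

Require Import Defs.
From HB Require Import structures.
From mathcomp Require Import all_boot all_order all_algebra.
From mathcomp Require Import all_classical all_reals all_analysis.
From mathcomp Require Import zify ring lra fintype finset.

Set Implicit Arguments.
Unset Strict Implicit.
Unset Printing Implicit Defensive.

Import Order.TTheory GRing.Theory Num.Theory.
Import numFieldNormedType.Exports.

(** * Tilings *)

(** When p is of order 1 / n, the random graph leaves linearly many vertices isolated, so a
    prescribed vertex can be placed only through edges of G. This is why a copy of F is split: one
    vertex hangs on edges of G, as a leaf of a tree or as the vertex closing a path into a cycle,
    and the rest is sought in the random graph inside linear sets.

    A (k-1)-set is then completed by a share 1 / c of the vertices, not by all of them. A unit with
    t links misses about a share ((c-1) / c)^t, while its size is linear in t. About 4 n / T units,
    each missing at most n / T vertices, fit into the graph once T exceeds a multiple of the size of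
    a unit; since exponentials beat linear functions, some t achieves both.

    The parameters form a chain without a circle: the scale used for completions yields c,
    absorption turns c into the share 1 / g of vertices that exchanges and almost tilings must
    handle, and only then are the scales for these two chosen. So spreadness is needed at finitely
    many scales, all known from k and eta, and these determine C. *)

Section SetReasoning.
Variable V : finType.
Implicit Types A B : {set V}.

Lemma disjoint_memF A B x : [disjoint A & B] -> ~~ ((x \in A) && (x \in B)).
Proof. by move=> d; apply/negP => /andP[xA]; rewrite (disjointFr d xA). Qed.

Lemma subset_memb A B x : A \subset B -> (x \in A) ==> (x \in B).
Proof. by move=> /subsetP s; apply/implyP; apply: s. Qed.

Lemma disjoint_of_mem A B :
  (forall x, ~~ ((x \in A) && (x \in B))) -> [disjoint A & B].
Proof.
move=> h; rewrite disjoints_subset; apply/subsetP => x xA; rewrite inE.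
by move: (h x); rewrite xA.
Qed.

Lemma subset_of_mem A B : (forall x, (x \in A) ==> (x \in B)) -> A \subset B.
Proof. by move=> h; apply/subsetP => x; apply/implyP. Qed.

Lemma card_disjointU A B : [disjoint A & B] -> #|A :|: B| = #|A| + #|B|.
Proof.
by move=> d; rewrite -cardsUI (disjoint_setI0 d) cards0 addn0.
Qed.

Lemma card_setU_le A B : #|A :|: B| <= #|A| + #|B|.
Proof. by rewrite -cardsUI leq_addr. Qed.

Lemma card_setD_ge A B : #|A| <= #|A :\: B| + #|B|.
Proof.
rewrite -(cardsID B A) addnC leq_add2l.
by apply: subset_leq_card; apply: subsetIr.
Qed.

End SetReasoning.

(** Disjointness, inclusion and equality of sets are instantiated at one point [x]; what remains is
    propositional in the memberships of [x]. *)
Ltac set_hyps x :=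
  repeat match goal with
  | H : is_true (disjoint _ _) |- _ => move: (disjoint_memF x H); clear H
  | H : is_true (subset _ _) |- _ => move: (subset_memb x H); clear H
  | H : @eq (set_of _) _ _ |- _ => move/setP/(_ x): H
  end.

Ltac bool_cases :=
  cbn [andb orb negb implb addb]; try done;
  match goal with
  | |- context [@in_mem ?T ?x ?A] => case: (@in_mem T x A); bool_cases
  | |- context [?x == ?y] => case: (x == y); bool_cases
  | |- _ => lia
  end.

Ltac mem_solve x := set_hyps x; rewrite ?inE; clear; bool_cases.

Ltac set_solve :=
  let x := fresh "x" in
  match goal with
  | |- is_true (disjoint _ _) => apply: disjoint_of_mem => x; mem_solve x
  | |- is_true (subset _ _) => apply: subset_of_mem => x; mem_solve x
  | |- @eq _ _ _ => apply/setP => x; mem_solve x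
  end.

Section Tilings.
Variables (V : finType) (E : {set {set V}}).
Implicit Types X Y e S W : {set V}.

(** Only the covered set is recorded; [tiled_factor] recovers the individual copies by induction on
    the derivation. *)
Inductive tiled : {set V} -> Prop :=
| tiled0 : tiled set0
| tiled_add X e : e \in E -> [disjoint e & X] -> tiled X -> tiled (e :|: X).

Lemma tiled1 e : e \in E -> tiled e.
Proof.
move=> eE; rewrite -[e]setU0; apply: tiled_add => //; last exact: tiled0.
by set_solve.
Qed.

Lemma tiledU X Y : tiled X -> tiled Y -> [disjoint X & Y] -> tiled (X :|: Y).
Proof.
move=> tX tY; elim: tX => [|X' e eE d tX IH] dXY; first by rewrite set0U.
rewrite -setUA; apply: tiled_add => //; first by set_solve.
by apply: IH; set_solve.
Qed.

Variable k : nat.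
Hypothesis E_card : forall e, e \in E -> #|e| = k.

Lemma tiled_card X : tiled X -> k %| #|X|.
Proof.
elim=> [|X' e eE d tX IH]; first by rewrite cards0 dvdn0.
by rewrite card_disjointU // dvdn_add // E_card.
Qed.

(** Needed to give back whole tiles until an exact number of vertices is left uncovered. *)
Lemma tiled_shrink X j : tiled X -> j * k <= #|X| ->
  exists Y, [/\ Y \subset X, tiled Y & #|Y| = j * k].
Proof.
move=> tX; elim: tX j => [|X' e eE d tX IH] j le_j.
  by exists set0; split=> //; [exact: tiled0 | move: le_j; rewrite cards0; lia].
have [le_j'|gt_j'] := leqP (j * k) #|X'|.
  have [Y [sY tY cY]] := IH _ le_j'.
  by exists Y; split=> //; set_solve.
exists (e :|: X'); split=> //; first by exact: tiled_add.
have /dvdnP[i ci] := tiled_card tX.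
move: le_j gt_j'; rewrite card_disjointU // E_card // ci -mulSn => le_j gt_j.
move: gt_j; rewrite ltn_mul2r => /andP[k_gt0 lt_ij].
move: le_j; rewrite leq_mul2r => /orP[/eqP|]; first by lia.
by move=> ?; congr (_ * _); lia.
Qed.

(** Averaging over the #|X| / k tiles: if each had weight at most [b], the total would be at most
    #|X| b / k. *)
Lemma tiled_heavy_tile X (f : V -> nat) b : tiled X ->
  #|X| * b < k * \sum_(x in X) f x ->
  exists e, [/\ e \in E, e \subset X, tiled (X :\: e) & b < \sum_(x in e) f x].
Proof.
elim=> [|X' e eE d tX IH]; first by rewrite big_set0 cards0 muln0.
rewrite card_disjointU // E_card // (big_setID e) /=.
have -> : (e :|: X') :&: e = e by set_solve.
have -> : (e :|: X') :\: e = X' by set_solve.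
move=> hb; have [hbe|hbe] := ltnP b (\sum_(x in e) f x).
  exists e; split=> //; first by set_solve.
  by have -> : (e :|: X') :\: e = X' by set_solve.
have [|e' [e'E sub te' be']] := IH; first by nia.
exists e'; split=> //; first by set_solve.
have -> : (e :|: X') :\: e' = e :|: (X' :\: e') by set_solve.
by apply: tiled_add => //; set_solve.
Qed.

End Tilings.

Lemma map_uniq_inj (T1 T2 : eqType) (f : T1 -> T2) (s : seq T1) :
  uniq (map f s) -> {in s &, injective f}.
Proof.
elim: s => [|x s IH] //= /andP[fx u] a b; rewrite !inE.
move=> /orP[/eqP ->|a_s] /orP[/eqP ->|b_s] // e.
- by case/negP: fx; rewrite e map_f.
- by case/negP: fx; rewrite -e map_f.
- exact: IH.
Qed.

(* If every vertex on either side misses at most a quarter of the other side, a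
   matching that is not perfect can be enlarged, possibly after exchanging the
   partners of one matched pair with a free pair. *)
Lemma perfect_matching (V : finType) m (L : {set V}) (r : V -> 'I_m -> bool) :
  #|L| = m ->
  (forall v, v \in L -> 4 * #|[set i | ~~ r v i]| <= m) ->
  (forall i, 4 * #|[set v in L | ~~ r v i]| <= m) ->
  exists s : seq (V * 'I_m),
    [/\ uniq (map fst s), uniq (map snd s), size s = m,
      {subset map fst s <= L} & all (fun p => r p.1 p.2) s].
Proof.
move=> cL hv hi.
suff: forall j, j <= m -> exists s : seq (V * 'I_m),
    [/\ uniq (map fst s), uniq (map snd s), size s = j,
      {subset map fst s <= L} & all (fun p => r p.1 p.2) s].
  exact.
elim=> [|j IH] lt_jm; first by exists [::].
have [s [u1 u2 szs sub rs]] := IH (ltnW lt_jm).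
pose F := [set i | i \notin map snd s].
have cF : #|F| = m - j.
  have := cardC (mem (map snd s)); rewrite (card_uniqP u2) size_map szs card_ord.
  by rewrite (eq_card (_ : _ =i F)) => [|i]; rewrite ?inE //; lia.
have [v vL vs] : exists2 v, v \in L & v \notin map fst s.
  apply/exists_inP; apply: contraT => /exists_inPn h.
  have : #|L| <= #|map fst s|.
    by apply/subset_leq_card/subsetP => x /h; rewrite negbK.
  by rewrite (card_uniqP u1) size_map szs cL leqNgt lt_jm.
have [/existsP[i /andP[iF rvi]]|noF] := boolP [exists i, (i \in F) && r v i].
  exists ((v, i) :: s); split=> //=.
  - by rewrite vs.
  - by move: iF; rewrite inE => ->.
  - by rewrite szs.
  - by move=> x; rewrite inE => /orP[/eqP ->|/sub].
  - by rewrite rvi.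
have missF : #|F| <= #|[set i | ~~ r v i]|.
  apply/subset_leq_card/subsetP => i iF; rewrite inE; apply/negP => rvi.
  by move/existsP: noF; apply; exists i; rewrite iF.
have [i iF] : exists i, i \in F by apply/card_gt0P; rewrite cF subn_gt0.
(* Otherwise each of the [j] matched pairs is missed by [v] or by [i], so j <= m / 2; but [v] also
   misses all m - j free indices, so j >= 3 m / 4. *)
have [p ps /andP[rvp rpi]] : exists2 p, p \in s & r v p.2 && r p.1 i.
  apply/hasP; apply: contraT => /hasPn h.
  have us : uniq s by apply: (map_uniq (f := fst)).
  have c1 : #|[set p in s | ~~ r v p.2]| <= #|[set i | ~~ r v i]|.
    rewrite -(card_in_imset (f := snd) (D := [set p in s | ~~ r v p.2])).
      apply/subset_leq_card/subsetP => x /imsetP[q]; rewrite !inE => /andP[_ h1] ->.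
      by [].
    move=> a b; rewrite !inE => /andP[ha _] /andP[hb _].
    exact: (map_uniq_inj u2 ha hb).
  have c2 : #|[set p in s | ~~ r p.1 i]| <= #|[set v in L | ~~ r v i]|.
    rewrite -(card_in_imset (f := fst) (D := [set p in s | ~~ r p.1 i])).
      apply/subset_leq_card/subsetP => x /imsetP[q]; rewrite !inE => /andP[q_s h1] ->.
      by rewrite h1 sub //; apply: map_f.
    move=> a b; rewrite !inE => /andP[ha _] /andP[hb _].
    exact: (map_uniq_inj u1 ha hb).
  have c3 : #|[set p in s | ~~ r v p.2] :|: [set p in s | ~~ r p.1 i]| >= j.
    rewrite -szs -(card_uniqP us).
    apply/subset_leq_card/subsetP => q qs; rewrite !inE qs /=.
    by move: (h q qs); rewrite negb_and.
  have c4 := card_setU_le [set p in s | ~~ r v p.2] [set p in s | ~~ r p.1 i].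
  by move: (hv _ vL) (hi i) c1 c2 c3 c4 missF cF lt_jm; clear; lia.
have us : uniq s by apply: (map_uniq (f := fst)).
have ps1 : p.1 \in map fst s by apply: map_f.
have ps2 : p.2 \in map snd s by apply: map_f.
have pe := perm_to_rem ps.
have pe1 := perm_map fst pe; have pe2 := perm_map snd pe.
have := u1; rewrite (perm_uniq pe1) /= => /andP[n1 u1'].
have := u2; rewrite (perm_uniq pe2) /= => /andP[n2 u2'].
have vr : v \notin map fst (rem p s).
  by apply: contra vs; rewrite (perm_mem pe1) inE => ->; rewrite orbT.
have ir : i \notin map snd (rem p s).
  move: iF; rewrite inE; apply: contra.
  by rewrite (perm_mem pe2) inE => ->; rewrite orbT.
exists [:: (v, p.2), (p.1, i) & rem p s]; split=> /=.
- rewrite inE (negbTE vr) orbF n1 u1' !andbT.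
  by apply: contraNneq vs => ->.
- rewrite inE (negbTE n2) orbF ir u2' !andbT.
  by move: iF; rewrite inE; apply: contraNneq => <-.
- by rewrite size_rem // prednK ?szs // -szs; case: (s) ps.
- move=> x; rewrite !inE => /orP[/eqP -> //|/orP[/eqP ->|]]; first exact: sub.
  by move=> xr; apply: sub; rewrite (perm_mem pe1) inE xr orbT.
- rewrite rvp rpi /=; apply/allP => q /mem_rem qs.
  exact: (allP rs).
Qed.

(** * Absorption *)

(* Fractions are encoded by natural numbers: here W is a set of at most |V| / w
   forbidden vertices, and a set of vertices is large when it has at least |V| / g
   elements. *)
Definition completable (V : finType) (E : {set {set V}}) (k w c : nat) :=
  forall W U : {set V}, w * #|W| <= #|V| -> U != set0 ->
  exists P : {set V}, [/\ #|P| = k.-1, [disjoint P & W] &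
    #|U| <= c * #|[set u in U | (u \in P) || (u |: P \in E)]|].

(** The set [R] acts as a switch: it can be tiled with either of two vertices taken from prescribed
    large sets, and leaves the other one free for use elsewhere. *)
Definition exchangeable (V : finType) (E : {set {set V}}) (w g r : nat) :=
  forall W Y Y' : {set V}, w * #|W| <= #|V| ->
  #|V| <= g * #|Y| -> #|V| <= g * #|Y'| ->
  [disjoint Y & W] -> [disjoint Y' & W] ->
  exists y y' (R : {set V}), [/\ y \in Y, y' \in Y' & y != y'] /\
    [/\ #|R| <= r, [disjoint R & W], y \notin R, y' \notin R &
      tiled E (y |: R) /\ tiled E (y' |: R)].

Definition nearly_tileable (V : finType) (E : {set {set V}}) (w g : nat) :=
  forall W : {set V}, w * #|W| <= #|V| ->
  exists X, [/\ tiled E X, [disjoint X & W] & g * #|~: (X :|: W)| <= #|V|].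

Lemma mem_bigcup_seq (V : finType) (T : eqType) (F : T -> {set V}) (s : seq T) x :
  (x \in \bigcup_(p <- s) F p) = has (fun p => x \in F p) s.
Proof. by elim: s => [|p s IH]; rewrite ?big_nil ?big_cons inE //= IH. Qed.

Section Absorption.
Variables (V : finType) (E : {set {set V}}) (k w c r g T : nat).
Hypotheses (k_gt1 : 1 < k) (w_gt1 : 1 < w) (T_gt2 : 2 < T) (c_gt0 : 0 < c).
Hypothesis gE : g = 2 * T * c.
Hypothesis V_large : g * (k + k + r + 3) <= #|V|.
Hypothesis E_card : forall e, e \in E -> #|e| = k.
Hypothesis hcomp : completable E k w c.
Hypothesis hexch : exchangeable E w g r.
Hypothesis hnear : nearly_tileable E w g.
Implicit Types W S P Y U R X B : {set V}.

(** Bounds the size of one link: k - 1 vertices of the new piece, at most [r] of the switch, and the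
    two vertices that it exchanges. *)
Let step := k + r + k + 2.

Let V_gt0 : 0 < #|V|.
Proof. apply: leq_trans V_large; rewrite gE; nia. Qed.

(* S absorbs every vertex outside W and U; its piece P can be completed by any
   vertex of Y, and is the link by which S is extended. *)
Lemma partial_absorber t W : w * (#|W| + t.+1 * step) <= #|V| ->
  exists S P Y U,
   [/\ [disjoint S & W], #|S| <= t.+1 * step, k %| #|S|.+1
     & [disjoint U & W :|: S]] /\
   [/\ forall v, v \notin W -> v \notin S -> v \notin U -> tiled E (v |: S)
     , T * #|U| <= #|V| \/ c ^ t * #|U| <= c.-1 ^ t * #|V|
     , P \subset S /\ tiled E (S :\: P)
     , [disjoint Y & W :|: S] /\ forall y, y \in Y -> y |: P \in E
     & 2 * #|V| <= g * (#|Y| + (k + r + 2))].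
Proof.
elim: t => [|t IH] hW.
  have cW : #|W| + #|~: W| = #|V| by rewrite cardsC.
  have W_small : 2 * #|W| <= #|V| by move: hW w_gt1; clear; nia.
  have U_large : #|V| <= T.-1 * #|~: W| by move: cW W_small T_gt2; clear; nia.
  have [||P [cP dP hU]] := hcomp (W := W) (U := ~: W).
  - by move: hW; clear; nia.
  - by rewrite -card_gt0; move: U_large V_gt0; clear; nia.
  set N := [set u in _ | _] in hU.
  exists P, P, (N :\: P), (~: W :\: N :\: P); split; [split=> // | split=> //].
  - by rewrite cP /step; lia.
  - by rewrite cP prednK ?dvdnn //; lia.
  - by set_solve.
  - move=> v vW vP hv; apply: tiled1; apply: contraNT hv => h.
    by rewrite !inE vW (negbTE vP) (negbTE h).
  - right; rewrite !expn0 !mul1n; apply: max_card.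
  - by split=> //; rewrite setDv; exact: tiled0.
  - split; first by rewrite /N; set_solve.
    by move=> y; rewrite !inE => /andP[/negbTE ->] /andP[].
  - have hN := card_setD_ge N P; rewrite cP in hN.
    have hV : #|V| <= T.-1 * (c * #|N|).
      by apply: leq_trans U_large _; rewrite leq_mul2l hU orbT.
    have hN' : #|N| <= #|N :\: P| + (k + r + 2).
      by apply: leq_trans hN _; rewrite leq_add2l; clear; lia.
    have hTN : T.-1 * (c * #|N|) <= T * c * (#|N :\: P| + (k + r + 2)).
      rewrite -mulnA; apply: leq_mul; first exact: leq_pred.
      by rewrite leq_mul2l hN' orbT.
    rewrite gE -!mulnA leq_mul2l /=; rewrite -mulnA in hTN.
    exact: leq_trans hV hTN.
have [|S [P [Y [U [[dS cS kS dU] [absS smallU [PS tSP] [dY hY] cY]]]]]] := IH.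
  by apply: leq_trans hW; rewrite leq_mul2l leq_add2l leq_mul2r leqnSn !orbT.
have [U_small|U_large] := leqP (T * #|U|) #|V|.
  exists S, P, Y, U; split; split=> //; last by left.
  by apply: leq_trans cS _; rewrite leq_mul2r leqnSn orbT.
have cWS := card_setU_le W S.
have [||P' [cP' dP' hU]] := hcomp (W := W :|: S) (U := U).
- apply: leq_trans hW; rewrite leq_mul2l; apply/orP; right.
  by move: cWS cS; rewrite !mulSn; clear; lia.
- by rewrite -card_gt0; case: #|U| U_large => //; rewrite muln0.
set N := [set u in U | _] in hU.
have cN : 2 * #|V| <= g * #|N|.
  rewrite gE -!mulnA leq_mul2l /=; apply: leq_trans (ltnW U_large) _.
  by rewrite leq_mul2l hU orbT.
have NU : N \subset U by rewrite /N; set_solve.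
have NE z : z \in N -> z \notin P' -> z |: P' \in E.
  by rewrite inE => /andP[_ /orP[->|//]].
clearbody N.
have hN := card_setD_ge N P'; have hYP := card_setD_ge Y P'.
rewrite cP' in hN hYP.
have cWSP := card_setU_le (W :|: S) P'; rewrite cP' in cWSP.
have [||||| y [y' [R [[yY y'Y yy'] [cR dR yR y'R [tyR ty'R]]]]]] :=
  hexch (W := W :|: S :|: P') (Y := Y :\: P') (Y' := N :\: P').
- apply: leq_trans hW; rewrite leq_mul2l; apply/orP; right.
  by move: cWSP cWS cS; rewrite !mulSn /step; clear; lia.
- move: cY hYP V_large; clear; nia.
- move: cN hN V_large; clear; nia.
- by set_solve.
- by set_solve.
move: yY y'Y; rewrite !inE => /andP[yP' yY] /andP[y'P' y'N].
have y'P'E := NE _ y'N y'P'; have y'U := subsetP NU _ y'N.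
have yS : y \notin W :|: S by rewrite (disjointFr dY).
have y'S : y' \notin W :|: S by rewrite (disjointFr dU).
have yPE := hY _ yY.
(* The two states of the switch. If [y] completes [P] and [y'] goes to [R], the new piece [P'] stays
   open for a vertex of [N]. If [y'] completes [P'] and [y] goes to [R], the old set [S] is
   untouched and absorbs what it absorbed before. *)
have tyy' : tiled E (y |: P :|: (y' |: R)).
  apply: tiledU => //; first exact: tiled1.
  apply: disjoint_of_mem => x; move: yS y'S; set_hyps x; rewrite !inE.
  case: (x =P y) => [->|_]; first by rewrite (negbTE yy') (negbTE yR).
  case: (x =P y') => [->|_] /=; last by clear; bool_cases.
  by clear; bool_cases.
have tPR : tiled E (y' |: P' :|: (y |: R)).
  apply: tiledU => //; first exact: tiled1.
  apply: disjoint_of_mem => x; set_hyps x; rewrite !inE.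
  case: (x =P y) => [->|_]; first by rewrite eq_sym in yy'; 
    rewrite eq_sym (negbTE yy') (negbTE yP').
  by case: (x =P y') => [->|_] /=; rewrite ?(negbTE y'R) //; clear; bool_cases.
exists (S :|: P' :|: (R :|: [set y; y'])), P', (N :\: P' :\: (R :|: [set y; y'])),
  (U :\: N :\: (S :|: P' :|: (R :|: [set y; y']))).
have cyy : #|[set y; y']| = 2 by rewrite cards2 yy'.
have dRyy : [disjoint R & [set y; y']].
  apply: disjoint_of_mem => x; rewrite !inE.
  by case: (x =P y) => [->|_]; [|case: (x =P y') => [->|_]];
    rewrite ?(negbTE yR) ?(negbTE y'R) ?andbF.
have dyyW : [disjoint [set y; y'] & W :|: S :|: P'].
  apply: disjoint_of_mem => x; rewrite !inE; move: yS y'S; rewrite !inE.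
  by case: (x =P y) => [->|_]; [|case: (x =P y') => [->|_]];
    rewrite ?(negbTE yP') ?(negbTE y'P') ?orbF //= => h1 h2;
    rewrite ?(negbTE h1) ?(negbTE h2).
have cardS' : #|S :|: P' :|: (R :|: [set y; y'])| = #|S| + k.-1 + (#|R| + 2).
  rewrite card_disjointU; last by set_solve.
  rewrite card_disjointU; last by set_solve.
  by rewrite card_disjointU // cyy cP'.
split; split.
- by set_solve.
- by rewrite cardS' mulSn /step; move: cS cR; rewrite /step; clear; lia.
- rewrite cardS'.
  have := tiled_card E_card tyR; rewrite cardsU1 yR => hkR.
  have -> : (#|S| + k.-1 + (#|R| + 2)).+1 = #|S|.+1 + (k + (1 + #|R|)).
    by move: k_gt1; clear; lia.
  by rewrite dvdn_add // dvdn_addr.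
- by set_solve.
- move=> v vW; rewrite !inE !negb_or => /andP[/andP[vS vP'] /andP[vR]].
  move=> /andP[vy vy'] hv.
  have [vN|vN] := boolP (v \in N).
    have vPE := NE _ vN vP'.
    have -> : v |: (S :|: P' :|: (R :|: [set y; y'])) =
        (S :\: P) :|: ((v |: P') :|: (y |: P :|: (y' |: R))).
      apply/setP => x; set_hyps x; rewrite !inE.
      by clear; bool_cases.
    have d1 : [disjoint v |: P' & y |: P :|: (y' |: R)].
      apply: disjoint_of_mem => x; move: (disjoint_memF x dyyW); set_hyps x;
        rewrite !inE.
      case: (x =P v) => [->|_]; first by rewrite (negbTE vy) (negbTE vy') (negbTE vR)
        (negbTE vS) /=; clear; bool_cases.
      by clear; bool_cases.
    apply: tiledU => //; first by apply: tiledU => //; exact: tiled1.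
    apply: disjoint_of_mem => x; move: (disjoint_memF x dyyW); set_hyps x; rewrite !inE.
    case: (x =P v) => [->|_]; first by rewrite (negbTE vS) andbF.
    by clear; bool_cases.
  have -> : v |: (S :|: P' :|: (R :|: [set y; y'])) =
      (v |: S) :|: (y' |: P' :|: (y |: R)).
    by apply/setP => x; rewrite !inE; clear; bool_cases.
  apply: tiledU => //.
    by apply: absS => //; apply: contra hv => ->;
      rewrite vN (negbTE vS) (negbTE vP') (negbTE vR) (negbTE vy) (negbTE vy').
  apply: disjoint_of_mem => x; move: (disjoint_memF x dyyW); set_hyps x; rewrite !inE.
  case: (x =P v) => [->|_]; first by rewrite (negbTE vy) (negbTE vy') (negbTE vR)
    (negbTE vP').
  by clear; bool_cases.
(* [N] contains at least a share 1 / c of [U], so the missed set shrinks by the factor (c - 1) /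
   c. *)
- have [//|hU'] : T * #|U| <= #|V| \/ c ^ t * #|U| <= c.-1 ^ t * #|V| by [].
    by rewrite leqNgt U_large.
  right; rewrite !expnS.
  have h1 : #|U :\: N :\: (S :|: P' :|: (R :|: [set y; y']))| <= #|U| - #|N|.
    apply: leq_trans (_ : #|U :\: N| <= _); first by apply: subset_leq_card; set_solve.
    by rewrite cardsD (setIidPr NU).
  have h2 : c * #|U :\: N :\: (S :|: P' :|: (R :|: [set y; y']))| <= c.-1 * #|U|.
    by move: h1 hU c_gt0; clear; nia.
  rewrite -mulnA mulnCA.
  apply: leq_trans (_ : c ^ t * (c.-1 * #|U|) <= _); first by rewrite leq_mul2l h2 orbT.
  by rewrite mulnCA -mulnA leq_mul2l hU' orbT.
- split; first by set_solve.
  have -> : (S :|: P' :|: (R :|: [set y; y'])) :\: P' = (S :\: P) :|: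
    (y |: P :|: (y' |: R)).
    apply/setP => x; move: (disjoint_memF x dyyW); set_hyps x; rewrite !inE; clear;
      bool_cases.
  apply: tiledU => //.
  apply: disjoint_of_mem => x; move: (disjoint_memF x dyyW); set_hyps x; rewrite !inE.
  by clear; bool_cases.
- split; first by set_solve.
  by move=> z; rewrite !inE => /andP[_ /andP[zP' zN]]; apply: NE.
- have := card_setD_ge (N :\: P') (R :|: [set y; y']).
  rewrite (card_disjointU dRyy) cyy; move: cN hN cR; clear; nia.
Qed.

Variable t0 : nat.
Hypothesis t0_large : T * c.-1 ^ t0 <= c ^ t0.
Let s := t0.+1 * step.

Lemma absorber W : w * (#|W| + s) <= #|V| ->
  exists S U, [/\ [disjoint S & W], #|S| <= s, k %| #|S|.+1, T * #|U| <= #|V|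
    & forall v, v \notin W -> v \notin S -> v \notin U -> tiled E (v |: S)].
Proof.
move=> hW; have [S [P [Y [U [[dS cS kS _] [absS cU _ _ _]]]]]] := partial_absorber hW.
exists S, U; split=> //; case: cU => // hU.
have c_pos : 0 < c ^ t0 by rewrite expn_gt0 c_gt0.
rewrite -(leq_pmul2l c_pos) mulnCA.
apply: leq_trans (_ : T * (c.-1 ^ t0 * #|V|) <= _); first by rewrite leq_mul2l hU orbT.
by rewrite mulnA leq_mul2r t0_large orbT.
Qed.

Lemma absorbers m : w * (m * s) <= #|V| ->
  exists (S U : nat -> {set V}),
    let Z := \bigcup_(i < m) S i in
    [/\ forall i, i < m -> T * #|U i| <= #|V|,
      forall i v, i < m -> v \notin Z -> v \notin U i -> tiled E (v |: S i),
      forall i j, i < j -> j < m -> [disjoint S i & S j],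
      k %| #|Z| + m & #|Z| <= m * s].
Proof.
elim: m => [|m IH] hm.
  exists (fun=> set0), (fun=> set0) => /=.
  by rewrite big_ord0 cards0; split=> //; rewrite dvdn0.
have [|S [U [cU absS dS kZ cZ]]] := IH.
  by apply: leq_trans hm; rewrite leq_mul2l leq_mul2r leqnSn !orbT.
have [|S' [U' [dS' cS' kS' cU' absS']]] := absorber (W := \bigcup_(i < m) S i).
  by apply: leq_trans hm; rewrite leq_mul2l mulSn addnC leq_add2l cZ orbT.
have eqS : \bigcup_(i < m) (if i == m :> nat then S' else S i) = \bigcup_(i < m) S i.
  by apply: eq_bigr => i _; rewrite (ltn_eqF (ltn_ord i)).
exists (fun i => if i == m then S' else S i), (fun i => if i == m then U' else U i).
rewrite /= big_ord_recr /= eqxx eqS.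
have cZ' : #|\bigcup_(i < m) S i :|: S'| = #|\bigcup_(i < m) S i| + #|S'|.
  by rewrite card_disjointU // disjoint_sym.
split.
- move=> i; rewrite ltnS leq_eqVlt => /orP[/eqP ->|lt_im]; first by rewrite eqxx.
  by rewrite (ltn_eqF lt_im); apply: cU.
- move=> i v; rewrite ltnS leq_eqVlt inE negb_or => + /andP[vZ vS'].
  move=> /orP[/eqP ->|lt_im]; first by rewrite eqxx => vU'; apply: absS'.
  by rewrite (ltn_eqF lt_im); apply: absS.
- move=> i j lt_ij; rewrite ltnS leq_eqVlt => /orP[/eqP ej|lt_jm].
    have lt_im : i < m by rewrite -ej.
    rewrite ej eqxx (ltn_eqF lt_im) disjoint_sym.
    by apply: disjointWr dS'; apply: (bigcup_sup (Ordinal lt_im)).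
  by rewrite (ltn_eqF lt_jm) (ltn_eqF (ltn_trans lt_ij lt_jm)); apply: dS.
- by rewrite cZ' -addnA [_ + m.+1]addnC addSnnS addnA dvdn_add // addnC.
- by rewrite cZ' mulSn addnC leq_add.
Qed.

(** Greedy, one tile per vertex of [B]. Completability is applied to a singleton, where capturing a
    positive share means capturing the vertex itself; adding [B] to the forbidden set keeps [v] and
    the rest of [B] out of [P]. *)
Lemma cover_small_set B W : [disjoint B & W] -> w * (#|W| + k * #|B|) <= #|V| ->
  exists X, [/\ tiled E X, B \subset X, [disjoint X & W] & #|X| <= k * #|B|].
Proof.
have [b] := ubnP #|B|; elim: b B W => // b IH B W le_b dBW hW.
have [->|[v vB]] := set_0Vmem B.
  by exists set0; split; rewrite ?cards0 //; [exact: tiled0 | set_solve].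
have cB : #|B| = #|B :\ v|.+1 by rewrite (cardsD1 v) vB.
have cWB := card_setU_le W B.
have [||P [cP dP hU]] := hcomp (W := W :|: B) (U := [set v]).
- by apply: leq_trans hW; rewrite leq_mul2l; move: cWB k_gt1; clear; nia.
- by apply/set0Pn; exists v; rewrite inE.
have vP : v \notin P by rewrite (disjointFl dP) // inE vB orbT.
have vPE : v |: P \in E.
  apply: contraTT hU => vPE; rewrite cards1 (eq_card0 (_ : _ =i pred0)) ?muln0 //.
  by move=> u; rewrite !inE; apply/andP => -[/eqP ->]; rewrite (negbTE vP) (negbTE vPE).
have cvP := card_setU_le W (v |: P); rewrite (E_card vPE) in cvP.
have [|||X [tX sBX dX cX]] := IH (B :\ v) (W :|: (v |: P)).
- by move: le_b; rewrite cB.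
- apply: disjoint_of_mem => x; set_hyps x; rewrite !inE.
  by case: (x == v) => //=; clear; bool_cases.
- by apply: leq_trans hW; rewrite leq_mul2l cB mulnS addnA leq_add2r cvP orbT.
exists (X :|: (v |: P)); split.
- by apply: tiledU => //; [exact: tiled1 | set_solve].
- by set_solve.
- have vW : v \in W = false := disjointFr dBW vB.
  apply: disjoint_of_mem => x; set_hyps x; rewrite !inE.
  by case: (x =P v) => [->|_]; [rewrite vW !andbF | clear; bool_cases].
- by apply: leq_trans (card_setU_le _ _) _;
  rewrite (E_card vPE) cB mulnS addnC leq_add2l.
Qed.

Hypotheses (T_large : 32 * (w * (s + k)) <= T) (V_large' : T <= #|V|).
Hypothesis k_dvd : k %| #|V|.

Theorem absorption_tiled : tiled E [set: V].
Proof.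
set f := #|V| %/ T.
have T_gt0 : 0 < T by apply: ltn_trans T_gt2.
have f_gt0 : 0 < f by rewrite divn_gt0.
have fT : f * T <= #|V| by apply: leq_divM.
have le_f A : T * A <= #|V| -> A <= f by move=> h; rewrite leq_divRL // mulnC.
(* A unit misses at most [f] vertices, so this [m] gives the quarter that the matching requires; it
   also exceeds the at most [f] vertices that the almost tiling leaves over. *)
set m := 4 * f.+1.
have hsz : 4 * (w * (m * s + k * (4 * f))) <= #|V|.
  apply: leq_trans fT; rewrite mulnC.
  move: T_large f_gt0; rewrite /m; clear; nia.
have [|S [U [cU absS dS kZ cZ]]] := absorbers (m := m).
  by move: hsz; clear; nia.
set Z := \bigcup_(i < m) S i in absS kZ cZ.
(* The vertices for which the matching condition fails. Each is missed by more than m / 4 units, and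
   there are at most m f misses in all, hence at most 4 f such vertices. *)
pose bad := [set v | (v \notin Z) && (m < 4 * #|[set i : 'I_m | v \in U i]|)].
have c_bad : #|bad| <= 4 * f.
  have h1 : \sum_(v in bad) m <= 4 * \sum_(v : V) #|[set i : 'I_m | v \in U i]|.
    rewrite big_distrr /= [X in _ <= X](bigID (mem bad)) /=;
      apply: leq_trans (leq_addr _ _).
    by apply: leq_sum => v; rewrite inE => /andP[_ /ltnW].
  have h2 : \sum_(v : V) #|[set i : 'I_m | v \in U i]| = \sum_(i < m) #|U i|.
    under eq_bigr do rewrite -sum1dep_card big_mkcond.
    rewrite exchange_big /=; apply: eq_bigr => i _.
    by rewrite -big_mkcond sum1_card.
  have h3 : \sum_(i < m) #|U i| <= \sum_(i < m) f.
    by apply: leq_sum => i _; apply/le_f/cU.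
  move: h1 h3; rewrite h2 !sum_nat_const card_ord => h1 h3.
  have m_gt0 : 0 < m by [].
  by rewrite -(leq_pmul2r m_gt0); apply: leq_trans h1 _;
    rewrite -mulnA [f * m]mulnC leq_mul2l.
have dbZ : [disjoint bad & Z].
  by apply: disjoint_of_mem => x; rewrite !inE; case: (x \in Z); rewrite ?andbF.
have [|XB [tXB sbX dXB cXB]] := cover_small_set dbZ.
  apply: leq_trans hsz; apply: leq_trans (leq_pmull _ _) => //.
  by rewrite leq_mul2l leq_add ?orbT // leq_mul2l c_bad orbT.
have cW := card_disjointU dXB.
have cXB' : #|XB| <= k * (4 * f) by apply: leq_trans cXB _;
  rewrite leq_mul2l c_bad orbT.
have [|X [tX dX cX]] := hnear (W := XB :|: Z).
  rewrite cW; apply: leq_trans hsz; apply: leq_trans (leq_pmull _ _) => //.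
  by rewrite leq_mul2l addnC leq_add ?orbT.
have cV : #|X| + #|XB :|: Z| + #|~: (X :|: (XB :|: Z))| = #|V|.
  by rewrite -card_disjointU // cardsC.
set L0 := ~: _ in cX cV.
have cL0 : #|L0| <= f.
  by apply: le_f; apply: leq_trans cX; rewrite leq_mul2r gE; apply/orP; right;
    move: c_gt0; clear; nia.
have lt_L0m : #|L0| <= m by apply: leq_trans cL0 _; rewrite /m; clear; lia.
(* Units have size -1 modulo [k], so the number of vertices still to be freed is a multiple of [k]
   and can be obtained by giving back whole tiles of [X]. *)
have k_m : k %| m - #|L0|.
  have kXB := tiled_card E_card tXB; have kX := tiled_card E_card tX.
  have e : #|V| + (m - #|L0|) = #|X| + #|XB| + (#|Z| + m).
    by move: cV cW lt_L0m; clear; lia.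
  by rewrite -(dvdn_addr _ k_dvd) e dvdn_add // dvdn_add.
have le_mX : m - #|L0| <= #|X|.
  have cWn : 4 * #|XB :|: Z| <= #|V|.
    apply: leq_trans hsz; rewrite cW leq_mul2l /=.
    apply: leq_trans (leq_pmull _ _); last by move: w_gt1; clear; lia.
    by rewrite addnC leq_add.
  have T32 : 32 <= T by move: T_large w_gt1 k_gt1; clear; nia.
  by move: cV cWn cL0 fT T32 f_gt0; rewrite /m; clear; nia.
have [|X' [sX' tX' cX']] := tiled_shrink (j := (#|X| - (m - #|L0|)) %/ k) E_card tX.
  by apply: leq_trans (leq_divM _ _) (leq_subr _ _).
rewrite divnK in cX'; last by rewrite dvdn_sub // (tiled_card E_card tX).
have dW : [disjoint X' & XB :|: Z] by set_solve.
set L := ~: (X' :|: (XB :|: Z)).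
have cL : #|L| = m.
  have := cardsC (X' :|: (XB :|: Z)); rewrite card_disjointU // -/L cX'.
  by move: cV lt_L0m le_mX; clear; lia.
have [||q [u1 u2 szq qL rq]] := perfect_matching
  (r := fun v (i : 'I_m) => v \notin U i) cL.
- move=> v; rewrite !inE !negb_or => /andP[_ /andP[vXB vZ]].
  have : v \notin bad by apply: contra vXB; apply: (subsetP sbX).
  rewrite inE vZ /= -leqNgt; apply: leq_trans; rewrite leq_mul2l /=.
  by apply/subset_leq_card/subsetP => i; rewrite !inE negbK.
- move=> i; apply: leq_trans (_ : 4 * #|U i| <= _).
    rewrite leq_mul2l /=; apply/subset_leq_card/subsetP => v; rewrite !inE negbK.
    by case/andP.
  by rewrite leq_mul2l /= (leq_trans (le_f _ (cU _ (ltn_ord i)))).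
have tq : tiled E (\bigcup_(p <- q) (p.1 |: S p.2)).
  have {}rq p : p \in q -> p.1 \notin U p.2 by move=> pq; exact: (allP rq p pq).
  have {}qL p : p \in q -> p.1 \notin Z.
    by move=> pq; have := qL p.1 (map_f _ pq); rewrite !inE !negb_or => /and3P[].
  have SZ (i : 'I_m) : S i \subset Z by apply: bigcup_sup.
  have dSS (i j : 'I_m) : i != j -> [disjoint S i & S j].
    by rewrite -val_eqE neq_ltn => /orP[]; [|rewrite disjoint_sym]; move=> ?; apply: dS.
  elim: q u1 u2 rq qL {szq} => [|p q IH] /=; first by rewrite big_nil => *;
    exact: tiled0.
  move=> /andP[p1 u1] /andP[p2 u2] rq qL; rewrite big_cons; apply: tiledU.
  - apply: absS; [by []| by apply: qL; rewrite inE eqxx | by apply: rq;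
    rewrite inE eqxx].
  - by apply: IH => // x xq; [apply: rq | apply: qL]; rewrite inE xq orbT.
  - apply: disjoint_of_mem => x; rewrite mem_bigcup_seq; apply/negP =>
    /andP[xp /hasP[p' p'q]].
    have pp1 : p.1 != p'.1 by apply: contraNneq p1 => ->; rewrite map_f.
    have pp2 : p.2 != p'.2 by apply: contraNneq p2 => ->; rewrite map_f.
    have z1 := qL p; have z2 := qL p'.
    rewrite inE eqxx in z1; rewrite inE p'q orbT in z2.
    move: xp; rewrite !inE => /orP[/eqP ->|xS] /orP[/eqP e|x'S].
    + by rewrite e eqxx in pp1.
    + by have := z1 isT; rewrite (subsetP (SZ _) _ x'S).
    + by have := z2 isT; rewrite -e (subsetP (SZ _) _ xS).
    + by rewrite (disjointFr (dSS _ _ pp2) xS) in x'S.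
have eq_q : \bigcup_(p <- q) (p.1 |: S p.2) = L :|: Z.
  apply/setP => x; rewrite mem_bigcup_seq; apply/hasP/idP => [[p pq]|].
    rewrite inE => /orP[]; first by rewrite inE => /eqP ->; rewrite inE qL // map_f.
    by move=> xS; rewrite inE; apply/orP; right; apply/bigcupP; exists p.2.
  rewrite inE => /orP[xL|/bigcupP[i _ xS]].
    have [|||_ eqL] := uniq_min_size (s1 := map fst q) (s2 := enum L) => //.
    + by move=> y /qL; rewrite mem_enum.
    + by rewrite -cardE cL size_map szq.
    have : x \in map fst q by rewrite eqL mem_enum.
    by case/mapP=> p pq ->; exists p; rewrite // !inE eqxx.
  have [|||_ eqI] := uniq_min_size (s1 := map snd q) (s2 := enum 'I_m) => //.
  + by move=> y _; rewrite mem_enum.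
  + by rewrite -cardE card_ord size_map szq.
  have : i \in map snd q by rewrite eqI mem_enum.
  by case/mapP=> p pq ei; exists p; rewrite // inE -ei xS orbT.
have -> : [set: V] = (X' :|: XB) :|: (L :|: Z) by rewrite /L; set_solve.
apply: tiledU.
- by apply: tiledU => //; set_solve.
- by rewrite -eq_q.
- by rewrite /L; set_solve.
Qed.

End Absorption.

(** Bernoulli's inequality (1 + 1 / a)^j >= 1 + j / a, cleared of denominators. *)
Lemma bernoulli_expn a j : a ^ j * (a + j) <= a.+1 ^ j * a.
Proof.
elim: j => [|j IH]; first by rewrite !expn0 addn0.
rewrite !expnS -[_ * a.+1 ^ j * a]mulnA.
apply: leq_trans (leq_mul (leqnn _) IH); move: (a ^ j) => x; nia.
Qed.

(** Chooses the number of links: with a + 1 = c, the share missed after t links falls below 1 / T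
    although T has to grow linearly with t. *)
Lemma expn_dominates_linear a b : exists t, b * t.+1 * a ^ t <= a.+1 ^ t.
Proof.
case: a => [|a]; first by exists 1; rewrite exp1n expn1 muln0.
case: b => [|b]; first by exists 0.
(* A single use of Bernoulli's inequality gives only linear growth, so it is used at [j] and
   squared. For q = d^2 (b + 1), the value j = 3 q works because q (2 j + 1) <= j^2. *)
set d := a.+1; set j := 3 * (d * d * b.+1); exists (j + j); rewrite !expnD.
have h := bernoulli_expn d j.
have d_gt0 : 0 < d * d by [].
rewrite -(leq_pmul2r d_gt0); move: h; set x := d ^ j; set y := _ ^ j => h.
have h2 := leq_mul h h.
apply: leq_trans (_ : y * d * (y * d) <= _); last by rewrite mulnACA.
apply: leq_trans h2; rewrite [X in _ <= X]mulnACA [X in X <= _]mulnAC mulnC.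
rewrite leq_mul2l; apply/orP; right.
have j_gt0 : 0 < j by [].
have -> : b.+1 * (j + j).+1 * (d * d) = (d * d * b.+1) * (j + j).+1 by lia.
move: j_gt0; rewrite /j; set q := d * d * b.+1; clear; nia.
Qed.

(** The order of the quantifiers matters: [g] depends on [k], [w], [c], [r] alone, so the scales
    that provide exchanges and almost tilings at share 1 / g can be chosen after it. *)
Theorem absorption (k w c r : nat) : 1 < k -> 1 < w -> 0 < c ->
  exists g n0, 3 < g /\ forall (V : finType) (E : {set {set V}}),
    n0 <= #|V| -> k %| #|V| -> (forall e, e \in E -> #|e| = k) ->
    completable E k w c -> exchangeable E w g r -> nearly_tileable E w g ->
    tiled E [set: V].
Proof.
move=> k_gt1 w_gt1 c_gt0.
set b := 32 * (w * ((k + r + k + 2) + k)).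
have [t ht] := expn_dominates_linear c.-1 b; rewrite prednK // in ht.
set T := b * t.+1 in ht.
exists (2 * T * c), (2 * T * c * (k + k + r + 3) + T); split.
  have : 2 < T by rewrite /T /b; move: w_gt1; clear; nia.
  by move: c_gt0; clear; nia.
move=> V E n_large kV cE hc he hn.
apply: (absorption_tiled (T := T) k_gt1 w_gt1 _ c_gt0 erefl _ cE hc he hn (t0 := t))
  => //.
- by rewrite /T /b; move: w_gt1; clear; nia.
- by apply: leq_trans n_large; apply: leq_addr.
- rewrite /T /b -!mulnA !leq_mul2l /=; apply/orP; right.
  by move: (k + r + k + 2) => x; clear; nia.
- by apply: leq_trans n_large; apply: leq_addl.
Qed.

(** * Counting tools *)

Lemma pigeonhole_card (V T : finType) (f : V -> T) (U : {set V}) : U != set0 ->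
  exists R, #|U| <= #|T| * #|[set u in U | f u == R]|.
Proof.
case/set0Pn=> u0 _; apply/existsP; apply: contraT => /existsPn h.
have T_gt0 : 0 < #|T| by apply/card_gt0P; exists (f u0).
have e : #|U| = \sum_(R : T) #|[set u in U | f u == R]|.
  rewrite -sum1_card (partition_big f predT) //=; apply: eq_bigr => R _.
  by rewrite -sum1_card; apply: eq_bigl => u; rewrite inE.
have : #|T| * \sum_(R : T) #|[set u in U | f u == R]| < #|T| * #|U|.
  rewrite big_distrr /= -[X in _ < X]sum_nat_const /=.
  have [R _] : exists R, R \in T by apply/card_gt0P.
  rewrite (bigD1 R) // [X in _ < X](bigD1 R) //= -addSn leq_add //.
    by rewrite ltnNge h.
  by apply: leq_sum => R' _; rewrite ltnW // ltnNge h.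
by rewrite -e ltnn.
Qed.

Lemma double_counting (S V : finType) (A : {set S}) (U : {set V})
  (r : S -> V -> bool) K : A != set0 -> U != set0 ->
  (forall u, u \in U -> #|A| <= K * #|[set s in A | r s u]|) ->
  exists2 s, s \in A & #|U| <= K * #|[set u in U | r s u]|.
Proof.
move=> A0 U0 h; apply/exists_inP; apply: contraT => /exists_inPn h'.
have e : \sum_(u in U) #|[set s in A | r s u]| = \sum_(s in A) #|[set u in U | r s u]|.
  under eq_bigr do rewrite -sum1dep_card.
  under [RHS]eq_bigr do rewrite -sum1dep_card.
  rewrite (exchange_big_dep (mem A)) /=; last by move=> u s _ /andP[].
  by apply: eq_bigr => s sA; apply: eq_bigl => u; rewrite sA.
have h1 : #|U| * #|A| <= K * \sum_(u in U) #|[set s in A | r s u]|.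
  by rewrite -sum_nat_const big_distrr; apply: leq_sum => u; apply: h.
have h2 : K * \sum_(s in A) #|[set u in U | r s u]| < #|A| * #|U|.
  rewrite big_distrr /= -sum_nat_const.
  have [s sA] := set0Pn _ A0.
  rewrite (bigD1 s) // [X in _ < X](bigD1 s) //= -addSn leq_add //.
    by rewrite ltnNge h'.
  by apply: leq_sum => s' /andP[s'A _]; rewrite ltnW // ltnNge h'.
by rewrite e in h1; have := leq_ltn_trans h1 h2; rewrite [#|U| * _]mulnC ltnn.
Qed.

Section Chunks.
Variable V : finType.
Implicit Types A : {set V}.

(* The i-th block of s consecutive elements of A; junk when s = 0. *)
Definition chunk A s i := [set x in A | index x (enum A) %/ s == i].

Lemma chunk_sub A s i : chunk A s i \subset A.
Proof. by apply/subsetP => x; rewrite inE => /andP[]. Qed.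

Lemma chunk_disjoint A s i j : i != j -> [disjoint chunk A s i & chunk A s j].
Proof.
move=> ij; apply: disjoint_of_mem => x; rewrite !inE.
apply/negP => /andP[/andP[_ /eqP ->] /andP[_ ij']].
by rewrite (negbTE ij) in ij'.
Qed.

Lemma card_chunk A s i : 0 < s -> i.+1 * s <= #|A| -> #|chunk A s i| = s.
Proof.
case: s => [//|s] _ h.
have [x0 x0A] : exists x, x \in A by apply/card_gt0P; apply: leq_trans h.
rewrite cardE in h.
have lt_j (j : 'I_s.+1) : i * s.+1 + j < size (enum A).
  by apply: leq_trans h; rewrite mulSn addnC ltn_add2r.
have -> : chunk A s.+1 i = [set nth x0 (enum A) (i * s.+1 + j) | j : 'I_s.+1].
  apply/setP => x; rewrite inE; apply/andP/imsetP => [[xA /eqP e]|[j _ ->]].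
    have lt_x : index x (enum A) %% s.+1 < s.+1 by rewrite ltn_mod.
    by exists (Ordinal lt_x); rewrite //= -e -divn_eq nth_index // mem_enum.
  rewrite -mem_enum mem_nth //; split=> //.
  by rewrite index_uniq ?enum_uniq // divnMDl // divn_small ?addn0.
rewrite card_imset ?card_ord // => j1 j2 /eqP.
rewrite nth_uniq ?enum_uniq // eqn_add2l => /eqP; exact: val_inj.
Qed.

End Chunks.

(** * Spread graphs *)

Lemma card_bigcup_le (V I : finType) (F : I -> {set V}) :
  #|\bigcup_i F i| <= \sum_i #|F i|.
Proof.
elim/big_rec2: _ => [|i m A _ h]; first by rewrite cards0.
by apply: leq_trans (card_setU_le _ _) _; rewrite leq_add2l.
Qed.

(** Counted in units of n / (16 q), [nb] has at least 16 vertices. [W] takes at most 8, the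
    remainder of the division into chunks fewer than 4, three chunks at most 3, and all poor chunks
    together at most 1; so three rich chunks are too few. Four are what the exchange of cycles
    uses. *)
Lemma rich_chunks (V : finType) (nb W : {set V}) q M :
  0 < q -> #|V| <= q * #|nb| -> 2 * q * #|W| <= #|V| -> 16 * q <= M ->
  4 * q * M < #|V| ->
  3 < #|[set i : 'I_M |
         #|V| <= 16 * q * M * #|nb :&: chunk (~: W) (#|~: W| %/ M) i|]|.
Proof.
move=> q_gt0 h_nb hW hM hV; set n := #|V| in h_nb hW hM hV *.
have M_gt0 : 0 < M by apply: leq_trans hM; rewrite muln_gt0.
set s := _ %/ M; set R := [set i | _]; rewrite ltnNge; apply/negP => cR.
pose c (i : 'I_M) := chunk (~: W) s i.
have cW : #|W| + #|~: W| = n by rewrite cardsC.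
have s_gt0 : 0 < s by rewrite divn_gt0 //; nia.
have hs : M * s <= #|~: W| by rewrite mulnC leq_divM.
have cc i : #|c i| = s.
  by rewrite card_chunk //; apply: leq_trans hs; rewrite leq_mul2r ltn_ord orbT.
have rest : #|~: W :\: \bigcup_i c i| <= M.
  apply: leq_trans (_ : #|drop (M * s) (enum (~: W))| <= _).
    apply/subset_leq_card/subsetP => x; rewrite in_setD => /andP[xc xW].
    have xe : x \in enum (~: W) by rewrite mem_enum.
    have : M * s <= index x (enum (~: W)).
      rewrite leqNgt; apply: contra xc => lt_x.
      have lt_i : index x (enum (~: W)) %/ s < M by rewrite ltn_divLR.
      by apply/bigcupP; exists (Ordinal lt_i); rewrite // inE xW /=.
    move=> le_x; rewrite -(nth_index x xe) -(subnKC le_x) -nth_drop.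
    by apply: mem_nth; rewrite size_drop ltn_sub2r // ?index_mem //
      (leq_ltn_trans le_x) ?index_mem.
  apply: leq_trans (card_size _) _; rewrite size_drop -cardE /s.
  have := divn_eq #|~: W| M; have := ltn_pmod #|~: W| M_gt0.
  by clear; lia.
have h1 : #|nb| <= #|W| + M + \sum_i #|nb :&: c i|.
  apply: leq_trans (_ : #|W :|: (~: W :\: \bigcup_i c i) :|:
    \bigcup_i (nb :&: c i)| <= _).
    apply/subset_leq_card/subsetP => x xnb; rewrite !inE; case: (x \in W) => //=.
    rewrite andbT; have [/bigcupP[i _ xi]|//] := boolP (x \in \bigcup_i c i).
    by apply/bigcupP; exists i; rewrite // inE xnb.
  apply: leq_trans (card_setU_le _ _) _; rewrite leq_add ?card_bigcup_le //.
  by apply: leq_trans (card_setU_le _ _) _; rewrite leq_add2l.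
have h2 : \sum_(i in R) #|nb :&: c i| <= 3 * s.
  apply: leq_trans (_ : \sum_(i in R) s <= _).
    by apply: leq_sum => i _; rewrite -(cc i) subset_leq_card // subsetIr.
  by rewrite sum_nat_const leq_mul2r cR orbT.
have h3 : 16 * q * M * \sum_(i in ~: R) #|nb :&: c i| <= M * n.
  rewrite big_distrr /=; apply: leq_trans (_ : \sum_(i in ~: R) n <= _).
    by apply: leq_sum => i; rewrite !inE -ltnNge => /ltnW.
  rewrite sum_nat_const leq_mul2r; apply/orP; right.
  by apply: leq_trans (max_card _) _; rewrite card_ord.
have h4 : \sum_i #|nb :&: c i| = \sum_(i in R) #|nb :&: c i| + \sum_(i in ~: R) #|nb
  :&: c i|.
  by rewrite (bigID (mem R)) /=; congr (_ + _); apply: eq_bigl => i; rewrite in_setC.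
rewrite h4 in h1; rewrite -[_ * M * _]mulnA mulnCA leq_pmul2l // in h3.
have h5 : 16 * q * s <= n.
  apply: leq_trans (_ : M * s <= _); first by rewrite leq_mul2r hM orbT.
  by apply: leq_trans hs _; rewrite -cW leq_addl.
move: h_nb hW hV h1 h2 h3 h5; rewrite /n; clear; nia.
Qed.

Section Spread.
Variables (V : finType) (h : rel V) (N K : nat).
Implicit Types A B I : {set V}.

Definition edges_between A B := [set p : V * V | [&& p.1 \in A, p.2 \in B & h p.1 p.2]].

(* The comparison between pairs of sets is what makes an average over the edges of
   h between A' and B' see those between A and B with weight at least 1 / K. *)
Definition spread := forall A B, [disjoint A & B] ->
  #|V| <= N * #|A| -> #|V| <= N * #|B| ->
  0 < #|edges_between A B| /\
  forall A' B', [disjoint A' & B'] ->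
    #|edges_between A' B'| <= K * #|edges_between A B|.

Hypothesis hS : spread.

Lemma spread_edge A B : [disjoint A & B] -> #|V| <= N * #|A| -> #|V| <= N * #|B| ->
  exists a b, [/\ a \in A, b \in B & h a b].
Proof.
move=> d hA hB; have [/card_gt0P[[a b]]] := hS d hA hB.
by rewrite inE => /and3P[? ? ?] _; exists a, b.
Qed.

(** Greedy: [B] has at least as many free vertices as [A], so as long as n / N vertices of [A] are
    unmatched, spreadness provides a further edge. *)
Lemma spread_matching A B : [disjoint A & B] -> #|A| <= #|B| -> 0 < #|V| ->
  exists I (t : V -> V), [/\ I \subset A, {in I &, injective t},
    forall a, a \in I -> t a \in B /\ h a (t a) & N * #|A :\: I| < #|V|].
Proof.
move=> d cAB V_gt0.
suff: forall b I (t : V -> V), #|A :\: I| <= b -> I \subset A ->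
  {in I &, injective t} ->
    (forall a, a \in I -> t a \in B /\ h a (t a)) ->
  exists I (t : V -> V), [/\ I \subset A, {in I &, injective t},
    forall a, a \in I -> t a \in B /\ h a (t a) & N * #|A :\: I| < #|V|].
  move/(_ #|A| set0 id); apply; rewrite ?setD0 ?sub0set // => a.
  by rewrite inE.
elim=> [|b IH] I t cI sIA t_inj tB.
  by exists I, t; split=> //; move: cI; rewrite leqn0 => /eqP ->; rewrite muln0.
have [?|big_A] := ltnP (N * #|A :\: I|) #|V|; first by exists I, t.
have big_B : #|V| <= N * #|B :\: (t @: I)|.
  apply: leq_trans big_A _; rewrite leq_mul2l; apply/orP; right.
  have tIB : t @: I \subset B by apply/subsetP => y /imsetP[a /tB[? _] ->].
  by rewrite !cardsD (setIidPr sIA) (setIidPr tIB) card_in_imset // leq_sub2r.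
have [|a [y [aA yB hay]]] := spread_edge _ big_A big_B; first by set_solve.
move: aA yB; rewrite !inE => /andP[aI aA] /andP[yt yB].
pose t' x := if x == a then y else t x.
have t't x : x \in I -> t' x = t x.
  by move=> xI; rewrite /t'; case: eqP xI => // ->; rewrite (negbTE aI).
apply: (IH (a |: I) t').
- have -> : A :\: (a |: I) = (A :\: I) :\ a by apply/setP => x; rewrite !inE; clear;
  bool_cases.
  by move: cI; rewrite (cardsD1 a (A :\: I)) !inE aI aA.
- by apply/subsetP => x; rewrite !inE => /orP[/eqP ->|/(subsetP sIA)].
- have tay x : x \in I -> t x <> y by move=> xI e; rewrite -e imset_f in yt.
  have t'a : t' a = y by rewrite /t' eqxx.
  move=> x1 x2; rewrite !inE => /orP[/eqP ->|x1I] /orP[/eqP ->|x2I] //;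
    rewrite ?t'a ?t't //.
  + by move=> /esym /tay; case.
  + by move/tay; case.
  + exact: t_inj.
- move=> x; rewrite !inE /t' => /orP[/eqP ->|xI]; first by rewrite eqxx.
  by rewrite -/(t' x) t't //; apply: tB.
Qed.

(** Matchings between consecutive sets are composed, each losing fewer than n / N starting points.
    The end [t a] of the path from [a] determines [a]; this lets edges leaving the ends count as
    paths. *)
Lemma spread_chain Zs A : 0 < #|V| ->
  pairwise (fun X Y : {set V} => [disjoint X & Y]) (A :: Zs) ->
  all (fun Z : {set V} => #|A| <= #|Z|) Zs ->
  exists I (t : V -> V) (pi : V -> seq V), [/\ I \subset A, {in I &, injective t},
    forall a, a \in I -> [/\ path h a (pi a), last a (pi a) = t a
      & all2 (fun x (Z : {set V}) => x \in Z) (pi a) Zs]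
    & N * #|A :\: I| <= size Zs * #|V|].
Proof.
move=> V_gt0; elim: Zs A => [|Z Zs IH] A.
  move=> _ _; exists A, id, (fun=> [::]); split=> //.
  by rewrite setDv cards0 muln0.
move=> /= /andP[/andP[dAZ _] pZ] /andP[cAZ cZs].
have [I1 [t1 [sI1 t1_inj t1Z cI1]]] := spread_matching dAZ cAZ V_gt0.
have t1sub : t1 @: I1 \subset Z by apply/subsetP => y /imsetP[a /t1Z[? _] ->].
have ct1 : #|t1 @: I1| = #|I1| by apply: card_in_imset.
have [||I2 [t2 [pi2 [sI2 t2_inj h2 cI2]]]] := IH (t1 @: I1).
- move: pZ => /= /andP[aZ ->]; rewrite andbT; apply: sub_all aZ => Y dZY;
  exact: disjointWl dZY.
- apply: sub_all cZs => Y; apply: leq_trans; rewrite ct1; exact: subset_leq_card.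
exists [set a in I1 | t1 a \in I2], (t2 \o t1), (fun a => t1 a :: pi2 (t1 a)); split.
- by apply/subsetP => x; rewrite inE => /andP[/(subsetP sI1)].
- move=> x y; rewrite !inE => /andP[xI xI2] /andP[yI yI2] /= /(t2_inj _ _ xI2 yI2).
  exact: t1_inj.
- move=> a; rewrite inE => /andP[/t1Z[aZ ha] /h2[p2 l2 a2]] /=.
  by rewrite ha aZ.
- have : #|A :\: [set a in I1 | t1 a \in I2]| <= #|A :\: I1| + #|t1 @: I1 :\: I2|.
    have -> : A :\: [set a in I1 | t1 a \in I2] = (A :\: I1) :|:
      (A :&: [set a in I1 | t1 a \notin I2]).
      by apply/setP => x; rewrite !inE; clear; bool_cases.
    apply: leq_trans (card_setU_le _ _) _; rewrite leq_add2l.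
    apply: leq_trans (_ : #|[set a in I1 | t1 a \notin I2]| <= _).
      by apply: subset_leq_card; apply: subsetIr.
    rewrite -(card_in_imset (f := t1)); last first.
      by move=> x y; rewrite !inE => /andP[xI _] /andP[yI _]; apply: t1_inj.
    apply/subset_leq_card/subsetP => y /imsetP[x]; rewrite !inE => /andP[xI xn] ->.
    by rewrite xn imset_f.
  move=> hX; apply: leq_trans (leq_mul (leqnn N) hX) _.
  by rewrite mulnDr /= mulSn leq_add // ltnW.
Qed.

Lemma all2_disjoint (p : seq V) (Zs : seq {set V}) A :
  all2 (fun x (Z : {set V}) => x \in Z) p Zs ->
    all (fun Z : {set V} => [disjoint A & Z]) Zs ->
  all (fun x => x \notin A) p.
Proof.
elim: p Zs => [|x p IH] [|Z Zs] //= /andP[xZ a2] /andP[dZ dZs].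
by rewrite (disjointFl dZ xZ) (IH Zs).
Qed.

Lemma all2_uniq (p : seq V) (Zs : seq {set V}) :
  all2 (fun x (Z : {set V}) => x \in Z) p Zs ->
  pairwise (fun X Y : {set V} => [disjoint X & Y]) Zs -> uniq p.
Proof.
elim: p Zs => [|x p IH] [|Z Zs] //= /andP[xZ a2] /andP[dZ pZ].
rewrite (IH _ a2 pZ) andbT; apply/negP => xp.
by have /allP/(_ _ xp) := all2_disjoint a2 dZ; rewrite xZ.
Qed.

(** A chain through [j] chunks of [A]. By the size condition a chunk has more than j n / N vertices,
    and the chain loses at most (j - 1) n / N of its starting points. *)
Lemma spread_path A j : 0 < #|V| -> 0 < j -> j * j * #|V| + N * j <= N * #|A| ->
  exists x p, [/\ path h x p, size p = j.-1, uniq (x :: p) & {subset x :: p <= A}].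
Proof.
move=> V_gt0 j_gt0 hA; set s := #|A| %/ j.
have N_gt0 : 0 < N by case: (N) hA => //; rewrite !mul0n addn0 leqn0 !muln_eq0; lia.
have s_gt0 : 0 < s.
  by rewrite divn_gt0 // -(leq_pmul2l N_gt0); apply: leq_trans hA; apply: leq_addl.
have hs : #|A| < s.+1 * j by rewrite -ltn_divLR.
have cc i : i < j -> #|chunk A s i| = s.
  move=> lt_ij; rewrite card_chunk //; apply: leq_trans (leq_divM #|A| j).
  by rewrite mulnC leq_mul2l lt_ij orbT.
pose Zs := [seq chunk A s i | i <- iota 1 j.-1].
have pw : pairwise (fun X Y : {set V} => [disjoint X & Y]) (chunk A s 0 :: Zs).
  rewrite -[chunk A s 0 :: Zs]/([seq chunk A s i | i <- iota 0 j.-1.+1]) pairwise_map.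
  have := iota_uniq 0 j.-1.+1; rewrite uniq_pairwise; apply: sub_pairwise => i i'.
  exact: chunk_disjoint.
have [|I [t [pi [sI _ hI cI]]]] := spread_chain V_gt0 pw.
  apply/allP => Z /mapP[i]; rewrite mem_iota => /andP[_ lt_i] ->.
  by rewrite !cc // -(prednK j_gt0).
have [x xI] : exists x, x \in I.
  apply/set0Pn; apply: contraL cI => /eqP ->.
  rewrite setD0 cc // size_map size_iota -ltnNge.
  rewrite -(ltn_pmul2l j_gt0) mulnCA; move: hA hs V_gt0 j_gt0 N_gt0; clear.
  by move: #|A| #|V| => a v; nia.
have [px _ a2] := hI _ xI.
have a2' : all2 (fun x (Z : {set V}) => x \in Z) (x :: pi x) (chunk A s 0 :: Zs).
  by rewrite /= a2 (subsetP sI).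
exists x, (pi x); split=> //.
- by have := a2; rewrite all2E size_map size_iota => /andP[/eqP].
- exact: all2_uniq a2' pw.
- have : all (fun Z : {set V} => Z \subset A) (chunk A s 0 :: Zs).
    by rewrite /= chunk_sub; apply/allP => Z /mapP[i _ ->]; apply: chunk_sub.
  move: a2'; move: (chunk A s 0 :: Zs) (x :: pi x); clear.
  elim=> [|Z Zs IH] [|x p] //= /andP[xZ a2] /andP[sZ sZs] y; rewrite inE.
  by move=> /orP[/eqP ->|yp]; [exact: (subsetP sZ) | exact: IH yp].
Qed.

End Spread.

(** * Cycles *)

Section Cycles.
Variables (V : finType) (E : {set {set V}}) (k : nat) (g h : rel V) (N K q : nat).
Hypothesis k_gt3 : 3 < k.
Hypothesis E_cycle : forall c, uniq c -> size c = k ->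
  cycle (fun x y => g x y || h x y) c -> [set x in c] \in E.
Hypothesis g_sym : symmetric g.
Hypothesis hS : spread h N K.
Hypothesis q_gt0 : 0 < q.
Implicit Types A B I U W X Y : {set V}.

Let nb u := [set x | g u x].
Let n := #|V|.
Hypothesis nb_large : forall u, n <= q * #|nb u|.

Let path_gh x p : path h x p -> path (fun x y => g x y || h x y) x p.
Proof. by apply: sub_path => a b ->; rewrite orbT. Qed.

(** Only the two edges at [u] come from [g], so nothing is asked of [u] in [h]. *)
Lemma path_completed u a p : path h a p -> size p = k.-2 -> uniq (a :: p) ->
  u \notin a :: p -> g u a -> g u (last a p) -> u |: [set x in a :: p] \in E.
Proof.
move=> hp sp up un ga gl.
have -> : u |: [set x in a :: p] = [set x in u :: a :: p].
  by apply/setP => x; rewrite !inE.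
apply: E_cycle; [by rewrite cons_uniq un | by rewrite /= sp; lia |].
by rewrite /= ga /= rcons_path path_gh // [g _ u]g_sym gl.
Qed.

(* A pair (a, b) with h (t a) b stands for a path of h from a through t a to b. *)
Lemma linked_ends I X U (t : V -> V) : {in I &, injective t} ->
  [disjoint t @: I & X] -> U != set0 ->
  (forall u, u \in U -> n <= N * #|nb u :&: I| /\ n <= N * #|nb u :&: X|) ->
  let S := [set p : V * V | [&& p.1 \in I, p.2 \in X & h (t p.1) p.2]] in
  S != set0 /\ forall u, u \in U ->
    #|S| <= K * #|[set p in S | (p.1 \in nb u) && (p.2 \in nb u)]|.
Proof.
move=> t_inj dtX U0 hU S.
(* Injectivity of [t] turns these pairs into edges of [h] between [t @: J] and [Y], to which
   spreadness applies. *)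
have pull (J Y : {set V}) : J \subset I ->
    #|[set p : V * V | [&& p.1 \in J, p.2 \in Y & h (t p.1) p.2]]| =
    #|edges_between h (t @: J) Y|.
  move=> /subsetP sJ; pose f (p : V * V) := (t p.1, p.2).
  rewrite -(card_in_imset (f := f)); last first.
    move=> [a b] [a' b']; rewrite !inE /f /= => /and3P[aJ _ _] /and3P[a'J _ _] [].
    by move=> /(t_inj _ _ (sJ _ aJ) (sJ _ a'J)) -> ->.
  apply: eq_card => -[y b]; rewrite inE /=; apply/imsetP/and3P.
    by case=> -[a b']; rewrite inE /= => /and3P[aJ bY hab] [-> ->]; split;
      rewrite ?imset_f.
  by case=> /imsetP[a aJ ->] bY hab; exists (a, b); rewrite // inE aJ bY.
have main u : u \in U -> 0 < #|[set p in S | (p.1 \in nb u) && (p.2 \in nb u)]| /\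
    #|S| <= K * #|[set p in S | (p.1 \in nb u) && (p.2 \in nb u)]|.
  move=> uU; have [h1 h2] := hU _ uU.
  have -> : [set p in S | (p.1 \in nb u) && (p.2 \in nb u)] =
      [set p : V * V | [&& p.1 \in nb u :&: I, p.2 \in nb u :&: X & h (t p.1) p.2]].
    by apply/setP => p; rewrite !inE; clear; bool_cases.
  rewrite (pull I X) // (pull (nb u :&: I) (nb u :&: X)) ?subsetIr //.
  have [||| e1 e2] := hS (A := t @: (nb u :&: I)) (B := nb u :&: X).
  - apply: disjointWl (disjointWr _ dtX);
    [exact: imsetS (subsetIr _ _) | exact: subsetIr].
  - rewrite card_in_imset // => x y; rewrite !inE => /andP[_ xI] /andP[_ yI].
    exact: t_inj.
  - exact: h2.
  - by split=> //; apply: e2.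
split=> [|u /main[]//].
have [u /main[+ _]] := set0Pn _ U0.
by case/card_gt0P=> p; rewrite inE => /andP[pS _]; apply/set0Pn; exists p.
Qed.

(** The rich chunks vary with [u], but there are only 2^M sets of chunks; by pigeonhole the same
    chunks serve a share 2^-M of [U]. *)
Lemma popular_chunks W U M : 2 * q * #|W| <= n -> 16 * q <= M -> 4 * q * M < n ->
  U != set0 ->
  exists R : {set 'I_M}, [/\ 3 < #|R|,
    #|U| <= 2 ^ M * #|[set u in U | R \subset [set i : 'I_M |
      n <= 16 * q * M * #|nb u :&: chunk (~: W) (#|~: W| %/ M) i|]]| &
    [set u in U | R \subset [set i : 'I_M |
      n <= 16 * q * M * #|nb u :&: chunk (~: W) (#|~: W| %/ M) i|]] != set0].
Proof.
move=> hW hM hn U0.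
pose f u := [set i : 'I_M | n <= 16 * q * M * #|nb u :&: chunk (~: W) (#|~: W| %/ M)
  i|].
have [R hR] := pigeonhole_card f U0.
have cT : #|{: {set 'I_M}}| = 2 ^ M.
  by rewrite -cardsT -powersetT card_powerset cardsT card_ord.
rewrite cT in hR.
have UR0 : [set u in U | f u == R] != set0.
  by apply: contraNneq U0 => e; move: hR; rewrite e cards0 muln0 leqn0 cards_eq0.
have sUR : [set u in U | f u == R] \subset [set u in U | R \subset f u].
  by apply/subsetP => u; rewrite !inE => /andP[-> /eqP ->] /=.
exists R; split.
- have [u] := set0Pn _ UR0; rewrite inE => /andP[_ /eqP <-].
  exact: rich_chunks.
- apply: leq_trans hR _; rewrite leq_mul2l subset_leq_card ?orbT //.
- by have [u uR] := set0Pn _ UR0; apply/set0Pn; exists u; apply: (subsetP sUR).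
Qed.

(** Paths run from one rich chunk to another through k - 3 further chunks. For every [u] in [UR], a
    share 1 / K of these paths has both ends adjacent to [u] in [g]; so some path is closed by a
    share 1 / K of [UR]. *)
Lemma cycles_completable M : M = 16 * q + k -> N = k * (16 * q * M) ->
  4 * q * M < n -> completable E k (2 * q) (2 ^ M * K).
Proof.
move=> eM eN hn W U hW U0.
have [|R [cR cUR UR0]] := popular_chunks hW _ hn U0; first by rewrite eM leq_addr.
set s := _ %/ M in cUR UR0; set UR := [set u in U | _] in cUR UR0.
have [i1 i1R] : exists i, i \in R by apply/card_gt0P; apply: leq_trans cR.
have [i2] : exists i, i \in R :\ i1.
  by apply/card_gt0P; move: cR; rewrite (cardsD1 i1) i1R; clear; lia.
rewrite !inE => /andP[i21 i2R].
pose ch (i : 'I_M) := chunk (~: W) s i.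
(* The inner vertices may come from any other chunks, rich or not; the summand [k] in [M] ensures
   that k - 3 of them exist. *)
pose js := take (k - 3) (enum (~: [set i1; i2])).
have js_uniq : uniq js by rewrite take_uniq // enum_uniq.
have js_mem i : i \in js -> i \notin [set i1; i2].
  by move/mem_take; rewrite mem_enum inE.
have sz_js : size js = k - 3.
  rewrite size_takel // -cardE; have e := cardsC [set i1; i2].
  by move: e; rewrite card_ord cards2 eq_sym i21 => e; move: e eM q_gt0; clear; lia.
pose Zs := [seq ch j | j <- js].
have M_gt0 : 0 < M by rewrite eM; clear -k_gt3; lia.
have cW : #|W| + #|~: W| = n by rewrite cardsC.
have s_gt0 : 0 < s by rewrite divn_gt0 //; move: hW hn cW q_gt0; clear; nia.
have cc i : #|ch i| = s.
  rewrite card_chunk //; apply: leq_trans (leq_divM #|~: W| M).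
  by rewrite mulnC leq_mul2l ltn_ord orbT.
have dch i j : i != j -> [disjoint ch i & ch j] by move=> ij; apply: chunk_disjoint.
have pw : pairwise (fun X Y : {set V} => [disjoint X & Y]) (ch i1 :: Zs).
  rewrite -[ch i1 :: Zs]/([seq ch j | j <- i1 :: js]) pairwise_map.
  have : uniq (i1 :: js).
    by rewrite cons_uniq js_uniq andbT; apply: contraTN isT => /js_mem;
      rewrite !inE eqxx.
  rewrite uniq_pairwise; apply: sub_pairwise => i j; exact: dch.
have n_gt0 : 0 < n by apply: leq_ltn_trans hn.
have [|I [t [pi [sI t_inj hI cI]]]] := spread_chain hS n_gt0 pw.
  by apply/allP => Z /mapP[i _ ->]; rewrite !cc.
have dX2 : all (fun Z : {set V} => [disjoint ch i2 & Z]) (ch i1 :: Zs).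
  rewrite /= dch //; apply/allP => Z /mapP[i /js_mem + ->].
  by rewrite !inE negb_or => /andP[_ ii2]; apply: dch; rewrite eq_sym.
have in2 a : a \in I -> all2 (fun x (Z : {set V}) => x \in Z) (a :: pi a) (ch i1 :: Zs).
  by move=> aI; have [_ _ ha] := hI _ aI; rewrite /= (subsetP sI).
have tX2 : [disjoint t @: I & ch i2].
  apply: disjoint_of_mem => x; apply/negP => /andP[/imsetP[a aI ->]].
  have [_ <- _] := hI _ aI; apply/negP.
  by apply: (allP (all2_disjoint (in2 _ aI) dX2)); apply: mem_last.
have [|S0 hS0] := linked_ends t_inj tX2 UR0.
  move=> u; rewrite inE => /andP[_ /subsetP hu].
  have := hu _ i1R; have := hu _ i2R; rewrite !inE => r2 r1; split.
    (* By the choice of [N], the vertex [u] has at least k n / N neighbours in this chunk, and the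
       chain loses at most (k - 3) n / N. *)
    have : #|nb u :&: ch i1| <= #|nb u :&: I| + #|ch i1 :\: I|.
      apply: leq_trans (card_setU_le _ _); apply: subset_leq_card.
      by apply/subsetP => x; rewrite !inE; clear; bool_cases.
    move: r1 cI; rewrite size_map sz_js -/(ch i1) => r1 cI hx.
    have : N * #|nb u :&: ch i1| <= N * #|nb u :&: I| + (k - 3) * n.
      by apply: leq_trans (leq_mul (leqnn N) hx) _; rewrite mulnDr leq_add2l.
    move: r1 k_gt3; rewrite eN; clear; nia.
  apply: leq_trans r2 _; rewrite -/(ch i2) eN leq_mul2r leq_pmull ?orbT //.
  by clear -k_gt3; lia.
have [[a b]] := double_counting S0 UR0 hS0.
rewrite inE => /and3P[/= aI bX hab] cU.
have [hp ht ha2] := hI _ aI.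
have up : uniq (a :: rcons (pi a) b).
  rewrite -rcons_cons rcons_uniq (all2_uniq (in2 _ aI) pw) andbT.
  by apply/negP => /(allP (all2_disjoint (in2 _ aI) dX2)); rewrite bX.
have szp : size (rcons (pi a) b) = k.-2.
  rewrite size_rcons; have := ha2; rewrite all2E size_map sz_js => /andP[/eqP -> _].
  by clear -k_gt3; lia.
exists [set x in a :: rcons (pi a) b]; split.
- by rewrite cardsE (card_uniqP up) /= szp; clear -k_gt3; lia.
- apply: disjoint_of_mem => x; rewrite inE -rcons_cons mem_rcons inE.
  have chW i y : y \in ch i -> y \notin W by move/(subsetP (chunk_sub _ _ _));
    rewrite inE.
  apply/negP => /andP[/orP[/eqP ->|xp]]; first by apply/negP/(chW i2).
  apply/negP; have : all (fun Z : {set V} => [disjoint W & Z]) (ch i1 :: Zs).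
    apply/allP => Z; rewrite -[ch i1 :: Zs]/([seq ch j | j <- i1 :: js]) =>
      /mapP[i _ ->].
    by apply: disjoint_of_mem => y; apply/negP => /andP[yW /chW]; rewrite yW.
  by move/(all2_disjoint (in2 _ aI))/allP; apply.
apply: leq_trans cUR _; rewrite -mulnA leq_mul2l; apply/orP; right.
apply: leq_trans cU _; rewrite leq_mul2l; apply/orP; right.
apply/subset_leq_card/subsetP => u; rewrite inE => /andP[uUR /andP[gua gub]].
rewrite !inE /= in gua gub; have [uU _] := setIdP uUR; rewrite inE uU /=.
have [//|un] := boolP (u \in _).
apply: path_completed => //.
- by rewrite rcons_path hp ht.
- by move: un; rewrite inE.
- by rewrite last_rcons.
Qed.

Lemma tiled_cat (c1 c2 : seq V) : uniq (c1 ++ c2) ->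
  tiled E [set x in c1] -> tiled E [set x in c2] -> tiled E [set x in c1 ++ c2].
Proof.
rewrite cat_uniq => /and3P[_ /hasPn d _] t1 t2.
have -> : [set x in c1 ++ c2] = [set x in c1] :|: [set x in c2].
  by apply/setP => x; rewrite !inE mem_cat.
apply: tiledU => //; apply: disjoint_of_mem => x; rewrite !inE andbC.
by apply/negP => /andP[/d]; apply/negP.
Qed.

(* The tiles are the cycles (a y b w), (a' ea) and (b' eb). Exchanging the roles of
   the primed and unprimed vertices frees y and uses y' instead. *)
Lemma exchange_gadget_half a y b a' b' (w ea eb : seq V) :
  uniq ((a :: y :: b :: w) ++ (a' :: ea) ++ (b' :: eb)) ->
  h a y -> h y b ->
  (forall x p, w = x :: p -> [/\ path h x p, g x b & g (last x p) a]) ->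
  (forall x p, ea = x :: p -> [/\ path h x p, g x a' & g (last x p) a']) ->
  (forall x p, eb = x :: p -> [/\ path h x p, g x b' & g (last x p) b']) ->
  size w = k - 3 -> size ea = k.-1 -> size eb = k.-1 ->
  tiled E (y |: [set z in [:: a; b; a'; b'] ++ (w ++ ea ++ eb)]).
Proof.
move=> u hay hyb hw hea heb sw sea seb.
have -> : y |: [set z in [:: a; b; a'; b'] ++ (w ++ ea ++ eb)] =
    [set z in (a :: y :: b :: w) ++ (a' :: ea) ++ (b' :: eb)].
  by apply/setP => z; rewrite !inE !(mem_cat, inE); clear; bool_cases.
have cyc a0 e : uniq (a0 :: e) -> (forall x p, e = x :: p ->
  [/\ path h x p, g x a0 & g (last x p) a0]) ->
    size e = k.-1 -> tiled E [set z in a0 :: e].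
  case: e => [|x p] ue he se; first by move: se k_gt3; rewrite /=; clear; lia.
  have [hp gx gl] := he x p erefl.
  have -> : [set z in a0 :: x :: p] = a0 |: [set z in x :: p].
    by apply/setP => z; rewrite !inE.
  apply: tiled1; apply: path_completed => //; rewrite ?[g a0 _]g_sym //.
  - by move: se; rewrite /=; clear; lia.
  - by move: ue; rewrite cons_uniq => /andP[].
  - by move: ue; rewrite cons_uniq => /andP[].
have := u; rewrite cat_uniq => /and3P[u1 _ u23].
have := u23; rewrite cat_uniq => /and3P[u2 _ u3].
apply: tiled_cat => //; last by apply: tiled_cat => //; apply: cyc.
case: w hw sw u1 {u u23} => [|x p] hw sw u1; first by move: sw k_gt3; rewrite /=;
  clear; lia.
have [hp gx gl] := hw x p erefl.
apply: tiled1; apply: E_cycle => //; first by move: sw k_gt3; rewrite /=; clear; lia.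
by rewrite /= hay hyb [g b x]g_sym gx rcons_path path_gh // gl !orbT.
Qed.

(** The switch lives in a linear set [N4] of common neighbours of four vertices: a path of [h]
    inside it closes through any of them. The exchanged [y] and [y'] are attached by edges of [h] to
    [a], [b] and to [a'], [b'], so they can be found in arbitrary large sets. *)
Lemma cycles_exchangeable d M N2 K2 : 0 < d -> M = 16 * (q + d) -> N = 32 * q * M ->
  spread h N2 K2 -> N2 = 4 * 2 ^ M * (K * K) * (k * k) ->
  4 * q * M < n -> N2 * (4 * k + 6) <= n ->
  exchangeable E (2 * q) d (3 * k).
Proof.
move=> d_gt0 eM eN hS2 eN2 hn hn2 W Y Y' hW hY hY' dY dY'.
have cW : #|W| + #|~: W| = n by rewrite cardsC.
have n_gt0 : 0 < n by apply: leq_ltn_trans hn.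
have cWn : n <= 2 * #|~: W| by move: hW cW q_gt0; clear; nia.
have [||R [cR cUR UR0]] := popular_chunks (U := ~: W) hW _ hn.
- by rewrite eM leq_mul2l leq_addr orbT.
- by rewrite -cards_eq0; move: cWn n_gt0; clear; lia.
set s := _ %/ M in cUR UR0; set UR := [set u in _ | _] in cUR UR0.
have M_gt0 : 0 < M by move: q_gt0; rewrite eM; clear; lia.
have s_gt0 : 0 < s by rewrite divn_gt0 //; move: cWn hn q_gt0; clear; nia.
pose ch (i : 'I_M) := chunk (~: W) s i.
have cc i : #|ch i| = s.
  rewrite card_chunk //; apply: leq_trans (leq_divM #|~: W| M).
  by rewrite mulnC leq_mul2l ltn_ord orbT.
have dch i j : i != j -> [disjoint ch i & ch j] by move=> ij; apply: chunk_disjoint.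
have chW i : [disjoint ch i & W].
  by have := chunk_sub (~: W) s i; rewrite -/(ch i) => ?; set_solve.
have [i1 [i2 [i3 [i4 [u_i iR]]]]] : exists i1 i2 i3 i4,
  uniq [:: i1; i2; i3; i4] /\ {subset [:: i1; i2; i3; i4] <= R}.
  move: cR; rewrite cardE; have := enum_uniq (mem R); have :
    {subset enum R <= R} by move=> i; rewrite mem_enum.
  case: (enum R) => [|i1 [|i2 [|i3 [|i4 l]]]] // sub ul _; exists i1, i2, i3, i4.
  split; first by move: ul; rewrite -[_ :: _]/([:: i1; i2; i3; i4] ++ l) cat_uniq =>
    /and3P[].
  by move=> i il; apply: sub; rewrite -[_ :: _]/([:: i1; i2; i3; i4] ++ l) mem_cat il.
have := u_i; rewrite /= !inE !negb_or !andbT =>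
  /and3P[/and3P[i12 i13 i14] /andP[i23 i24] i34].
pose X := ch i1 :|: ch i2 :|: (ch i3 :|: ch i4).
have cX : #|X| <= 4 * s.
  apply: leq_trans (card_setU_le _ _) _.
  have := card_setU_le (ch i1) (ch i2); have := card_setU_le (ch i3) (ch i4).
  by rewrite !cc; clear; lia.
(* This is the purpose of the summand [d] in [M]: the four chunks and [T1] together must leave [s]
   vertices in a set of size n / d. *)
have hs : 16 * d * s <= n.
  apply: leq_trans (_ : M * s <= _); first by rewrite leq_mul2r eM; apply/orP; right;
    clear; lia.
  by rewrite mulnC; apply: leq_trans (leq_divM _ _) _; rewrite -cW leq_addl.
pose T1 := chunk (Y :\: X) s 0.
have sT1 : T1 \subset Y :\: X by apply: chunk_sub.
have cT1 : #|T1| = s.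
  rewrite card_chunk // mul1n; have := card_setD_ge Y X.
  by move: cX hs hY d_gt0; clear; nia.
pose T2 := chunk (Y' :\: (X :|: T1)) s 0.
have sT2 : T2 \subset Y' :\: (X :|: T1) by apply: chunk_sub.
have cT2 : #|T2| = s.
  rewrite card_chunk // mul1n; have := card_setD_ge Y' (X :|: T1).
  have := card_setU_le X T1; rewrite cT1.
  by move: cX hs hY' d_gt0; clear; nia.
have pw : pairwise (fun A B : {set V} => [disjoint A & B])
    [:: ch i1; T1; ch i2; ch i3; T2; ch i4].
  rewrite /= !dch //= !andbT.
  have sX i : i \in [:: i1; i2; i3; i4] -> ch i \subset X.
    by rewrite !inE => /or4P[] /eqP ->; apply/subsetP => x; rewrite !inE => ->;
      rewrite ?orbT.
  have s1 : ch i1 \subset X by apply: sX; rewrite !inE eqxx.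
  have s2 : ch i2 \subset X by apply: sX; rewrite !inE eqxx ?orbT.
  have s3 : ch i3 \subset X by apply: sX; rewrite !inE eqxx ?orbT.
  have s4 : ch i4 \subset X by apply: sX; rewrite !inE eqxx ?orbT.
  clearbody T1 T2 X ch; clear -sT1 sT2 s1 s2 s3 s4 dch i12 i13 i14 i23 i24 i34.
  by repeat (apply/andP; split); rewrite ?dch //; set_solve.
have [||I [t [sI t_inj ht cI]]] := spread_matching hS (A := ch i1) (B := T1) _ _ n_gt0.
- by move: pw => /= /andP[/andP[]].
- by rewrite cc cT1.
have [||I' [t' [sI' t'_inj ht' cI']]] :=
  spread_matching hS (A := ch i3) (B := T2) _ _ n_gt0.
- by move: pw => /= /and5P[_ _ _ /andP[]].
- by rewrite cc cT2.
(* A rich chunk holds at least 2 n / N neighbours of [u], and the matching misses fewer than n / N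
   vertices of it. *)
have enough i (J : {set V}) u : i \in R -> J \subset ch i -> N * #|ch i :\: J| < n ->
  u \in UR ->
    n <= N * #|nb u :&: J|.
  move=> i_R sJ cJ; rewrite inE => /andP[_ /subsetP/(_ _ i_R)];
    rewrite inE -/(ch i) => r.
  have : #|nb u :&: ch i| <= #|nb u :&: J| + #|ch i :\: J|.
    apply: leq_trans (card_setU_le _ _); apply: subset_leq_card.
    by apply/subsetP => x; rewrite !inE; clear; bool_cases.
  move=> hx; have := leq_mul (leqnn N) hx; rewrite mulnDr eN => h2.
  by move: cJ r h2; rewrite eN; clear; nia.
have full i u : i \in R -> u \in UR -> n <= N * #|nb u :&: ch i|.
  by move=> i_R uR; apply: (enough i) => //; rewrite setDv cards0 muln0.
have dT i (J : {set V}) (f : V -> V) (T : {set V}) : [disjoint T & ch i] ->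
    (forall a, a \in J -> f a \in T /\ h a (f a)) -> [disjoint f @: J & ch i].
  by move=> dTi hf; apply: disjointWl dTi; apply/subsetP => x /imsetP[a /hf[? _] ->].
have [||S0 hSu] := linked_ends (X := ch i2) t_inj _ UR0.
- by apply: dT ht; move: pw => /= /and3P[_ /andP[]].
- move=> u uR; split; last by apply: full; rewrite ?iR // !inE eqxx ?orbT.
  by apply: (enough i1) => //; rewrite iR // !inE eqxx.
have [||S0' hSu'] := linked_ends (X := ch i4) t'_inj _ UR0.
- by apply: dT ht'; move: pw => /= /and5P[_ _ _ _ /andP[/andP[]]].
- move=> u uR; split; last by apply: full; rewrite ?iR // !inE eqxx ?orbT.
  by apply: (enough i3) => //; rewrite iR // !inE eqxx ?orbT.
set S := [set p : V * V | _] in S0 hSu; set S' := [set p : V * V | _] in S0' hSu'.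
(* Both pairs of ends are chosen in one average over the product of the two families, which costs
   the square of [K]. *)
pose r (p : (V * V) * (V * V)) u :=
  [&& p.1.1 \in nb u, p.1.2 \in nb u, p.2.1 \in nb u & p.2.2 \in nb u].
have [|u uR|[[a b] [a' b']]] := double_counting (A := setX S S') (r := r)
  (K := K * K) _ UR0.
- have [p pS] := set0Pn _ S0; have [p' pS'] := set0Pn _ S0'.
  by apply/set0Pn; exists (p, p'); rewrite in_setX pS.
- have -> (A A' : {set V * V}) : [set s0 in setX A A' | r s0 u] =
      setX [set p in A | (p.1 \in nb u) && (p.2 \in nb u)]
        [set p in A' | (p.1 \in nb u) && (p.2 \in nb u)].
    by apply/setP => -[p p']; rewrite !inE /r /= !inE; clear; bool_cases.
  by rewrite !cardsX mulnACA leq_mul ?hSu ?hSu'.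
rewrite in_setX /= => /andP[pS pS']; set N4 := [set u in UR | _] => cN4.
have [aI bX hab] : [/\ a \in I, b \in ch i2 & h (t a) b] by move: pS; rewrite inE =>
  /and3P[].
have [a'I b'X ha'b'] : [/\ a' \in I', b' \in ch i4 & h (t' a') b'] by move: pS';
  rewrite inE => /and3P[].
have hN4 u : u \in N4 -> [/\ g u a, g u b, g u a', g u b' & u \notin W].
  rewrite inE => /andP[+ /and4P[]]; rewrite !inE => /andP[uW _] /= h1 h2 h3 h4.
  by split.
have [yT hay] := ht _ aI; have [y'T ha'y'] := ht' _ a'I.
set y := t a in yT hay hab; set y' := t' a' in y'T ha'y' ha'b'.
pose F := [:: a; y; b; a'; y'; b'].
have uF : uniq F.
  by apply: all2_uniq pw; rewrite /= (subsetP sI) // yT bX (subsetP sI') // y'T b'X.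
(* [N2] is chosen so that [N4] has at least 2 k^2 n / N2 vertices. One half pays for the path, the
   other for its rounding term and the at most 3 k + 6 vertices used before. *)
have hpath (B : seq V) j : 0 < j -> j < k -> size B <= 6 + 3 * k ->
    exists x p, [/\ path h x p, size p = j.-1,
      uniq (x :: p) & {subset x :: p <= N4 :\: [set z in B]}].
  move=> j_gt0 lt_jk szB; apply: (spread_path hS2) => //.
  have cB : #|[set z in B]| <= 6 + 3 * k by rewrite cardsE;
    apply: leq_trans (card_size _) szB.
  have := card_setD_ge N4 [set z in B].
  have hN2 : n * (2 * (k * k)) <= N2 * #|N4|.
    have : n <= 2 * (2 ^ M * (K * K * #|N4|)).
      apply: leq_trans cWn _; rewrite leq_mul2l /=; apply: leq_trans cUR _.
      by rewrite leq_mul2l cN4 orbT.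
    by rewrite eN2; move: (2 ^ M) (K * K) (k * k) => e kk k2; clear; nia.
  move=> hx; have := leq_mul (leqnn N2) hx; rewrite mulnDr => hx2.
  have := leq_mul (leqnn N2) cB => hB.
  have hjk : j * j <= k * k by rewrite leq_mul // ltnW.
  have hjn : j * j * #|V| + N2 * j <= k * k * n + N2 * k.
    by rewrite leq_add // ?leq_mul2r ?hjk ?orbT // leq_mul2l ltnW ?orbT.
  apply: leq_trans hjn _; have k2 : 0 < k * k by rewrite muln_gt0 (ltn_trans _ k_gt3).
  move: hN2 hx2 hB hn2 k2; rewrite [n * _]mulnCA mul2n -addnn [n * (k * k)]mulnC.
  have : n <= k * k * n by rewrite leq_pmull // muln_gt0 (ltn_trans _ k_gt3).
  by move: (k * k * n) => kkn; clear; nia.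
have k1 : 0 < k - 3 by rewrite subn_gt0.
have k2 : 0 < k.-1 by move: k_gt3; clear; lia.
have [||x1 [p1 [hp1 sp1 u1 sub1]]] := hpath F (k - 3) k1.
- by move: k_gt3; clear; lia.
- by rewrite leq_addr.
have sz1 : size (x1 :: p1) = k - 3 by rewrite /= sp1 prednK.
have [||x2 [p2 [hp2 sp2 u2 sub2]]] := hpath (F ++ (x1 :: p1)) k.-1 k2.
- by move: k_gt3; clear; lia.
- by rewrite size_cat sz1; clear; rewrite /=; lia.
have sz2 : size (x2 :: p2) = k.-1 by rewrite /= sp2 prednK.
have [||x3 [p3 [hp3 sp3 u3 sub3]]] := hpath (F ++ (x1 :: p1) ++ (x2 :: p2)) k.-1 k2.
- by move: k_gt3; clear; lia.
- by rewrite !size_cat sz1 sz2; clear; rewrite /=; lia.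
have sz3 : size (x3 :: p3) = k.-1 by rewrite /= sp3 prednK.
set w := x1 :: p1 in sz1 sub1 sub2 sub3 u1; set ea := x2 :: p2 in sz2 sub2 sub3 u2.
set eb := x3 :: p3 in sz3 sub3 u3.
have avoid (B p : seq V) : {subset p <= N4 :\: [set z in B]} -> ~~ has (mem B) p.
  by move=> sp; apply/hasPn => z /sp; rewrite !inE => /andP[].
have uall : uniq (F ++ (w ++ ea ++ eb)).
  rewrite catA catA cat_uniq -catA (avoid _ _ sub3) u3 !andbT.
  by rewrite catA cat_uniq (avoid _ _ sub2) u2 !andbT cat_uniq (avoid _ _ sub1) u1
    !andbT.
have inN4 (B p : seq V) : {subset p <= N4 :\: [set z in B]} -> {subset p <= N4}.
  by move=> sp z /sp; rewrite in_setD => /andP[].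
have ends c (B : seq V) x p x' p' : (forall u, u \in N4 -> g u c) ->
  {subset x :: p <= N4 :\: [set z in B]} ->
    path h x p -> x :: p = x' :: p' -> [/\ path h x' p', g x' c & g (last x' p') c].
  move=> hc sp hp [<- <-]; split=> //; apply: hc; apply: (inN4 _ _ sp);
    first by rewrite inE eqxx.
  exact: mem_last.
have ends2 c c' (B : seq V) x p x' p' : (forall u, u \in N4 -> g u c /\ g u c') ->
  {subset x :: p <= N4 :\: [set z in B]} ->
    path h x p -> x :: p = x' :: p' -> [/\ path h x' p', g x' c & g (last x' p') c'].
  move=> hc sp hp [<- <-]; split=> //.
  - by have [] := hc x (inN4 _ _ sp _ (mem_head _ _)).
  - by have [] := hc (last x p) (inN4 _ _ sp _ (mem_last _ _)).
pose L := [:: a; b; a'; b'] ++ (w ++ ea ++ eb).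
have LW z : z \in L -> z \notin W.
  have chW' i v : v \in ch i -> v \notin W by move=> vi; rewrite (disjointFr (chW i)).
  rewrite /L mem_cat => /orP[|].
    rewrite !inE => /or4P[] /eqP ->; [exact: (chW' i1) _ (subsetP sI _ aI)
      | exact: (chW' i2) | exact: (chW' i3) _ (subsetP sI' _ a'I) | exact: (chW' i4)].
  rewrite !mem_cat => /or3P[zp|zp|zp].
  - by have [] := hN4 z (inN4 _ _ sub1 z zp).
  - by have [] := hN4 z (inN4 _ _ sub2 z zp).
  - by have [] := hN4 z (inN4 _ _ sub3 z zp).
have uyy : uniq (y :: y' :: L).
  rewrite (perm_uniq (_ : perm_eq _ (F ++ (w ++ ea ++ eb)))) //.
  by apply/permP => P; rewrite /L; clear; clearbody w ea eb;
    rewrite /= !count_cat /= ?count_cat /=; lia.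
have [yL y'L] : y \notin L /\ y' \notin L.
  by move: uyy; rewrite /= inE negb_or => /and3P[/andP[_ ->] ->].
have uL : uniq L by move: uyy; rewrite !cons_uniq => /and3P[].
have yy' : y != y' by move: uyy; rewrite /= inE negb_or => /and3P[/andP[]].
have ga u : u \in N4 -> g u a by case/hN4.
have gb u : u \in N4 -> g u b by case/hN4.
have ga' u : u \in N4 -> g u a' by case/hN4.
have gb' u : u \in N4 -> g u b' by case/hN4.
exists y, y', [set z in L]; split; split=> //.
- by have := subsetP sT1 _ yT; rewrite inE => /andP[].
- by have := subsetP sT2 _ y'T; rewrite inE => /andP[].
- rewrite cardsE; apply: leq_trans (card_size _) _.
  by rewrite !size_cat sz1 sz2 sz3 /=; move: k_gt3; clear; lia.
- by apply: disjoint_of_mem => z; rewrite inE; apply/negP => /andP[/LW/negbTE ->].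
- by rewrite inE.
- by rewrite inE.
split.
  apply: (@exchange_gadget_half a y b a' b' w ea eb) => //.
  - rewrite (perm_uniq (_ : perm_eq _ (y :: L))) ?cons_uniq ?yL //.
    by apply/permP => P; rewrite /L; clear; clearbody w ea eb;
      rewrite /= !count_cat /= ?count_cat /=; lia.
  - by move=> x p; apply: ends2 sub1 hp1 => u uN; rewrite gb ?ga.
  - by move=> x p; apply: ends sub2 hp2.
  - by move=> x p; apply: ends sub3 hp3.
have -> : [set z in L] = [set z in [:: a'; b'; a; b] ++ (w ++ ea ++ eb)].
  by apply/setP => z; rewrite !inE !mem_cat !inE; clear; bool_cases.
apply: (@exchange_gadget_half a' y' b' a b w ea eb) => //.
- rewrite (perm_uniq (_ : perm_eq _ (y' :: L))) ?cons_uniq ?y'L //.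
  by apply/permP => P; rewrite /L; clear; clearbody w ea eb;
    rewrite /= !count_cat /= ?count_cat /=; lia.
- by move=> x p; apply: ends2 sub1 hp1 => u uN; rewrite gb' ?ga'.
- by move=> x p; apply: ends sub2 hp2.
- by move=> x p; apply: ends sub3 hp3.
Qed.

(** If at most one vertex of [e] reached weight m / c, it would contribute at most [l] and the
    others at most k m / c together. *)
Lemma two_heavy (e : {set V}) (f : V -> nat) (c m l : nat) : 0 < c ->
  #|e| = k -> (forall x, f x <= l) ->
  c * l + k * m < c * \sum_(x in e) f x ->
  exists x x', [/\ x \in e, x' \in e, x != x', m <= c * f x & m <= c * f x'].
Proof.
move=> c_gt0 ce fl hsum; pose H := [set x in e | m <= c * f x].
have small : \sum_(x in e :\: H) c * f x <= k * m.
  apply: leq_trans (_ : \sum_(x in e :\: H) m <= _).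
    by apply: leq_sum => x; rewrite !inE => /andP[+ xe]; rewrite xe -ltnNge => /ltnW.
  rewrite sum_nat_const leq_mul2r; apply/orP; right.
  by rewrite -ce subset_leq_card // subsetDl.
have sH : H \subset e by apply/subsetP => x; rewrite inE => /andP[].
have hH : c * l < \sum_(x in H) c * f x.
  move: hsum; rewrite big_distrr (big_setID H) /= (setIidPr sH).
  by move: small; clear; lia.
have : 1 < #|H|.
  rewrite ltnNge; apply/negP => cH; move: hH; rewrite ltnNge => /negP; apply.
  apply: leq_trans (_ : \sum_(x in H) c * l <= _).
    by apply: leq_sum => x _; rewrite leq_mul2l fl orbT.
  by rewrite sum_nat_const; move: cH; case: #|H| => [|[|]] //; rewrite ?mul0n ?mul1n.
case/card_gt1P => x [x' [xH x'H xx']]; exists x, x'.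
by move: xH x'H; rewrite !inE => /andP[-> ->] /andP[-> ->].
Qed.

(** The whole path is sought among the neighbours of [x], so its ends are neighbours too. The set
    [B] protects vertices already in use. *)
Lemma path_completed_in d N2 K2 (L B : {set V}) x : 0 < d -> spread h N2 K2 ->
  N2 = 8 * q * d * (k * k) -> 2 * (k * N2) <= n -> 0 < n -> #|B| <= k ->
  n <= 4 * q * d * #|nb x :&: L| -> x \in B ->
  exists P : {set V}, [/\ P \subset L :\: B, #|P| = k.-1 & x |: P \in E].
Proof.
move=> d_gt0 hS2 eN2 hn n_gt0 cB hx xB.
have [||y [p [hp sp up sub]]] := spread_path (A := nb x :&: L :\: B) (j := k.-1) hS2
  n_gt0.
- by move: k_gt3; clear; lia.
- have := card_setD_ge (nb x :&: L) B; move: hx hn cB.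
  have kk : k.-1 * k.-1 <= k * k by rewrite leq_mul // leq_pred.
  have k0 : 0 < k by move: k_gt3; clear; lia.
  have h1 : k.-1 * k.-1 * #|V| + N2 * k.-1 <= k * k * n + N2 * k.
    by rewrite leq_add // ?leq_mul2r ?kk ?orbT // leq_mul2l leq_pred orbT.
  move=> hx hn' cB' hD; apply: leq_trans h1 _.
  have h2 : 2 * (k * k * n) <= N2 * #|nb x :&: L|.
    rewrite eN2; move: (k * k) hx => c; clear; nia.
  have h3 := leq_mul (leqnn N2) (leq_trans hD (leq_add (leqnn _) cB')).
  have h4 : n <= k * k * n by rewrite leq_pmull // muln_gt0 k0.
  rewrite mulnDr in h3; move: h2 h3 hn' h4; rewrite [k * N2]mulnC; clear.
  by rewrite -/n; move: (N2 * k) (k * k * n) => a b; lia.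
have sP : [set z in y :: p] \subset nb x :&: L :\: B by apply/subsetP => z;
  rewrite inE => /sub.
exists [set z in y :: p]; split.
- apply: subset_trans sP _; apply: setSD; exact: subsetIr.
- by rewrite cardsE (card_uniqP up) /= sp; move: k_gt3; clear; lia.
- have adj z : z \in y :: p -> g x z by move=> /sub; rewrite !inE => /andP[_ /andP[]].
  apply: path_completed => //.
  + by apply/negP => /sub; rewrite !inE xB.
  + by apply: adj; rewrite inE eqxx.
  + by apply: adj; apply: mem_last.
Qed.

Hypothesis E_card : forall e, e \in E -> #|e| = k.

(* Either an uncovered vertex closes a path of h among the uncovered vertices, or
   the degree condition sends so many edges of g from the uncovered set to X that
   some tile has two vertices that do, and this tile is replaced by two. *)
Lemma cycles_enlarge d N2 K2 W X : 0 < d -> spread h N2 K2 ->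
  N2 = 8 * q * d * (k * k) -> 2 * (k * N2) <= n -> 0 < n ->
  (forall u, (q + k) * n <= k * q * #|nb u|) -> 4 * q * #|W| <= n ->
  tiled E X -> [disjoint X & W] -> n < d * #|~: (X :|: W)| ->
  exists Y, [/\ tiled E Y, [disjoint Y & W] & #|X| < #|Y|].
Proof.
move=> d_gt0 hS2 eN2 hn n_gt0 hdeg hW tX dXW; set L := ~: _ => hL.
have k0 : 0 < k by move: k_gt3; clear; lia.
have dLX : [disjoint L & X] by rewrite /L; set_solve.
have dLW : [disjoint L & W] by rewrite /L; set_solve.
have inL z : (z \in L) = ~~ ((z \in X) || (z \in W)) by rewrite !inE.
clearbody L.
have [/existsP[u /andP[uL hu]]|noU] :=
  boolP [exists u, (u \in L) && (n <= 4 * q * d * #|nb u :&: L|)].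
  have [|P [sP cP uPE]] := path_completed_in (B := [set u]) d_gt0 hS2 eN2 hn n_gt0 _
    hu (set11 u).
    by rewrite cards1.
  have sPL : u |: P \subset L.
    by apply/subsetP => z; rewrite !inE => /orP[/eqP -> //|/(subsetP sP)];
      rewrite !inE => /andP[].
  exists (X :|: (u |: P)); split.
  - by apply: tiledU => //; [exact: tiled1 | set_solve].
  - by set_solve.
  - by rewrite card_disjointU ?(E_card uPE); [lia | set_solve].
pose f x := #|nb x :&: L|.
have fL x : f x <= #|L| by apply: subset_leq_card; apply: subsetIr.
have hsum : \sum_(x in X) f x = \sum_(u in L) #|nb u :&: X|.
  under eq_bigr do rewrite /f -sum1_card.
  under [RHS]eq_bigr do rewrite -sum1_card.
  rewrite (exchange_big_dep (mem L)) /=; last by move=> x u _; rewrite inE => /andP[].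
  apply: eq_bigr => u uL; apply: eq_bigl => x.
  by rewrite !inE uL andbT g_sym andbC.
(* The degree of [u] is at least n / k + n / q; [W] and [L] receive at most n / (4 q) each, so n / k
   + n / (2 q) neighbours lie in [X]. *)
have hu u : u \in L -> (2 * q + k) * n <= 2 * (k * q) * #|nb u :&: X|.
  move=> uL; have nu : 4 * q * d * #|nb u :&: L| < n.
    by rewrite ltnNge; apply: contra noU => ?; apply/existsP; exists u; rewrite uL.
  have : #|nb u| <= #|W| + #|nb u :&: X| + #|nb u :&: L|.
    apply: leq_trans (_ : #|(W :|: (nb u :&: X)) :|: (nb u :&: L)| <= _).
      apply/subset_leq_card/subsetP => z; rewrite !inE inL => ->.
      by case: (z \in W); case: (z \in X).
    apply: leq_trans (card_setU_le _ _) _; rewrite leq_add2r; exact: card_setU_le.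
  move=> hc; have := leq_trans (hdeg u) (leq_mul (leqnn (k * q)) hc).
  rewrite !mulnDr.
  have h1 : 4 * (k * q * #|W|) <= k * n by move: hW; clear; nia.
  have h2 : 4 * (k * q * #|nb u :&: L|) <= k * n by move: nu d_gt0; clear; nia.
  by move: h1 h2; clear; nia.
have hsum2 : #|L| * ((2 * q + k) * n) <= 2 * (k * q) * \sum_(x in X) f x.
  by rewrite hsum big_distrr -sum_nat_const; apply: leq_sum => u; apply: hu.
(* There are at most n / k tiles, so an average tile receives at least (1 + k / (2 q)) #|L| edges
   from [L]. One vertex accounts for at most #|L| of them; as #|L| > n / d, the excess is above [b]
   and forces a second heavy vertex. *)
set b := (k * n) %/ (4 * q * d).
have c_gt0 : 0 < 4 * q * d by rewrite !muln_gt0 q_gt0.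
have hb : b * (4 * q * d) <= k * n by apply: leq_divM.
have cX : #|X| <= n by apply: max_card.
have [|e [eE seX tXe he]] := tiled_heavy_tile E_card (f := f) (b := #|L| + b) tX.
  have hb2 : 2 * q * b < k * #|L|.
    rewrite -(ltn_pmul2l d_gt0); apply: leq_ltn_trans (_ : k * n < _).
      by move: hb; clear; nia.
    by rewrite mulnCA ltn_pmul2l.
  rewrite -(ltn_pmul2l (_ : 0 < 2 * q)) ?muln_gt0 //.
  apply: leq_ltn_trans (_ : 2 * q * (n * (#|L| + b)) < _).
    by rewrite leq_mul2l leq_mul2r cX !orbT.
  apply: leq_trans (_ : #|L| * ((2 * q + k) * n) <= _).
    by move: hb2 n_gt0; clear; nia.
  by move: hsum2; rewrite -!mulnA [q * (k * _)]mulnCA.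
have [||x [x' [xe x'e xx' hx hx']]] :=
  two_heavy (e := e) (f := f) (m := n) (l := #|L|) c_gt0 _ fL.
- exact: E_card.
- apply: leq_trans (_ : 4 * q * d * (#|L| + b).+1 <= _);
  last by rewrite leq_mul2l he orbT.
  rewrite -[(_ + b).+1]addnS mulnDr ltn_add2l /b.
  by rewrite [_ * _.+1]mulnC ltn_ceil.
have xX := subsetP seX _ xe; have x'X := subsetP seX _ x'e.
have [|P [sP cP xPE]] := path_completed_in (B := [set x]) d_gt0 hS2 eN2 hn n_gt0 _ hx
  (set11 x).
  by rewrite cards1.
have [||P' [sP' cP' x'PE]] := path_completed_in (B := x' |: P) d_gt0 hS2 eN2 hn n_gt0
  _ hx' _.
- by apply: leq_trans (card_setU_le _ _) _; rewrite cards1 cP add1n prednK.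
- by rewrite !inE eqxx.
have xL : x \notin L by rewrite (disjointFl dLX).
have x'L : x' \notin L by rewrite (disjointFl dLX).
have sPL : P \subset L by set_solve.
have sPL' : P' \subset L :\: P by set_solve.
have d1 : [disjoint x |: P & x' |: P'].
  apply: disjoint_of_mem => z; set_hyps z; rewrite !inE.
  case: (z =P x) => [->|_]; first by rewrite (negbTE xx') (negbTE xL) /=; clear;
    bool_cases.
  by case: (z =P x') => [->|_]; rewrite ?(negbTE x'L); clear; bool_cases.
have d2 : [disjoint X :\: e & (x |: P) :|: (x' |: P')].
  apply: disjoint_of_mem => z; set_hyps z; rewrite !inE.
  case: (z =P x) => [->|_]; first by rewrite xe.
  by case: (z =P x') => [->|_]; rewrite ?x'e // ; clear; bool_cases.
exists ((X :\: e) :|: ((x |: P) :|: (x' |: P'))); split.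
- by apply: tiledU => //; apply: tiledU => //; apply: tiled1.
- apply: disjoint_of_mem => z; have := disjointFr dXW xX; have := disjointFr dXW x'X.
  move=> x'W xW; set_hyps z; rewrite !inE.
  case: (z =P x) => [->|_]; first by rewrite xW !andbF.
  by case: (z =P x') => [->|_]; rewrite ?x'W ?andbF //; clear; bool_cases.
- rewrite card_disjointU // card_disjointU // (E_card xPE) (E_card x'PE).
  have := card_setD_ge X e; rewrite (E_card eE); move: k0; clear; lia.
Qed.

Lemma cycles_nearly_tileable d N2 K2 : 0 < d -> spread h N2 K2 ->
  N2 = 8 * q * d * (k * k) -> 2 * (k * N2) <= n -> 0 < n ->
  (forall u, (q + k) * n <= k * q * #|nb u|) -> nearly_tileable E (4 * q) d.
Proof.
move=> d_gt0 hS2 eN2 hn n_gt0 hdeg W hW.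
suff: forall b X, tiled E X -> [disjoint X & W] -> n - #|X| <= b ->
    exists X, [/\ tiled E X, [disjoint X & W] & d * #|~: (X :|: W)| <= n].
  by move/(_ n set0); apply; [exact: tiled0 | set_solve | rewrite leq_subr].
elim=> [|b IH] X tX dX hb.
all: have [?|hL] := leqP (d * #|~: (X :|: W)|) n; first by exists X.
all: have [Y [tY dY cXY]] := cycles_enlarge d_gt0 hS2 eN2 hn n_gt0 hdeg hW tX dX hL.
all: have cY : #|Y| <= n by apply: max_card.
- by move: hb cXY cY; clear; lia.
- by apply: (IH Y) => //; move: hb cXY cY; clear; lia.
Qed.

End Cycles.

(** * Trees *)

(** A tree given by an order in which it grows leaf by leaf, the form in which the embedding
    consumes it. *)
Inductive grown (U : finType) (t : rel U) : {set U} -> Prop :=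
| grown1 x : grown t [set x]
| grown_add S x y : grown t S -> y \in S -> x \notin S -> t y x ->
    (forall z, z \in S -> t z x -> z = y) -> grown t (x |: S).

Section Trees.
Variables (V U : finType) (t : rel U) (E : {set {set V}}) (g h : rel V) (N K q : nat).
Let k := #|U|.
Let n := #|V|.
Hypothesis k_gt1 : 1 < k.
Hypotheses (t_sym : symmetric t) (t_irr : irreflexive t).
Hypotheses (g_sym : symmetric g) (h_sym : symmetric h).
Hypothesis E_copy : forall f : U -> V, injective f ->
  (forall x y, t x y -> g (f x) (f y) || h (f x) (f y)) -> f @: [set: U] \in E.
Hypothesis hS : spread h N K.
Hypothesis t_grown : grown t [set: U].
Hypotheses (N_gt0 : 0 < N) (N_le_n : N <= n).

Let n_gt0 : 0 < n.
Proof. exact: leq_trans N_le_n. Qed.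

(** The last leaf [x] is placed after the rest: [A y] is first cut down to the vertices with an
    [h]-neighbour in [A x]. This loses fewer than n / N vertices, since more would be joined to
    [A x] by an edge, and the requirement drops by n / N with the size of [S]. *)
Lemma grown_embedding (S : {set U}) (A : U -> {set V}) : grown t S ->
  (forall x y, x != y -> [disjoint A x & A y]) ->
  (forall x, x \in S -> #|S| * n <= N * #|A x|) ->
  exists f : U -> V, (forall x, x \in S -> f x \in A x) /\
    forall x y, x \in S -> y \in S -> t x y -> h (f x) (f y).
Proof.
move=> gS; elim: gS A => [r|{}S x y gS IH yS xS tyx tx] A dA cA.
  have := cA r (set11 r); rewrite cards1 mul1n => hr.
  have [v vA] : exists v, v \in A r.
    by apply/card_gt0P; case: #|A r| hr => //; rewrite muln0 leqNgt n_gt0.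
  exists (fun=> v); split=> [z|z z']; first by rewrite inE => /eqP ->.
  by rewrite !inE => /eqP -> /eqP ->; rewrite t_irr.
have yx : y != x by apply: contraNneq xS => <-.
pose By := [set v in A y | [exists u in A x, h v u]].
have sub_By : By \subset A y by apply/subsetP => v; rewrite inE => /andP[].
pose A' z := if z == y then By else A z.
have sA' z : A' z \subset A z.
  by rewrite /A'; case: eqP => // ->.
rewrite cardsU1 xS in cA.
have cBy : #|S| * n <= N * #|By|.
  have cAy := cA y (setU1r _ yS).
  have [lt_n|ge_n] := ltnP (N * #|A y :\: By|) n.
    by move: lt_n cAy (card_setD_ge (A y) (A y :\: By)); rewrite setDDr setDv set0U;
      rewrite (setIidPr (_ : By \subset A y)) ?(sub_By) //; clear; nia.
  have [|||a [b [aA bA hab]]] := spread_edge hS (A := A y :\: By) (B := A x) => //.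
  - by apply: disjointWl (dA _ _ yx); apply: subsetDl.
  - by apply: leq_trans (cA x (setU11 _ _)); rewrite leq_pmull.
  move: aA; rewrite inE => /andP[/negP aB aA]; case: aB.
  by rewrite inE aA; apply/exists_inP; exists b.
have [||f [fA fh]] := IH A'.
- by move=> a b ab; apply: disjointWl (sA' a) (disjointWr (sA' b) (dA _ _ ab)).
- move=> z zS; rewrite /A'; case: eqP => [_|_]; first exact: cBy.
  by apply: leq_trans (cA z (setU1r _ zS)); rewrite leq_mul2r leq_addl orbT.
have := fA y yS; rewrite /A' eqxx inE => /andP[_ /exists_inP[u uA hu]].
have neS z : z \in S -> z == x = false by move=> zS; apply: contraNF xS => /eqP <-.
exists (fun z => if z == x then u else f z); split.
- move=> z; rewrite !inE; case: eqP => [-> //|_] /= zS.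
  exact: (subsetP (sA' z)) (fA z zS).
- move=> a b; rewrite !inE; case: eqP => [->|_] /= aS; case: eqP => [->|_] /= bS.
  + by rewrite t_irr.
  + by rewrite t_sym => /(tx _ bS) ->; rewrite h_sym.
  + by move/(tx _ aS) => ->.
  + exact: fh.
Qed.

Lemma leaf_exists : exists l p (S : {set U}), [/\ grown t S, S = ~: [set l],
  p \in S & forall z, t z l -> z = p].
Proof.
suff aux S : grown t S -> S = [set: U] -> exists l p (S : {set U}),
    [/\ grown t S, S = ~: [set l], p \in S & forall z, t z l -> z = p].
  exact: aux t_grown erefl.
case=> [x|S' l p gS' pS lS _ hl] e.
  by have := k_gt1; rewrite /k -cardsT -e cards1.
exists l, p, S'; split=> //.
  apply/setP => z; rewrite !inE; have : z \in [set: U] by rewrite inE.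
  by rewrite -e !inE; case: (z =P l) => [->|_] /=; [rewrite (negbTE lS) | move=> ->].
move=> z tz; apply: hl => //; have : z \in [set: U] by rewrite inE.
by rewrite -e !inE => /orP[/eqP zl|//]; rewrite zl t_irr in tz.
Qed.

(** [h] carries the tree without [l]; any new vertex adjacent to the image of [p], in either graph,
    can play the leaf. *)
Lemma leaf_completed (l p : U) (f : U -> V) (u : V) :
  (forall z, t z l -> z = p) -> {in ~: [set l] &, injective f} ->
  (forall x y, x \in ~: [set l] -> y \in ~: [set l] -> t x y -> h (f x) (f y)) ->
  u \notin f @: (~: [set l]) -> g (f p) u || h (f p) u ->
  u |: f @: (~: [set l]) \in E.
Proof.
move=> hl f_inj fh un gu.
pose f' x := if x == l then u else f x.
have -> : u |: f @: (~: [set l]) = f' @: [set: U].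
  apply/setP => v; rewrite !inE; apply/orP/imsetP => [[/eqP ->|/imsetP[x]]|[x _ ->]].
  - by exists l; rewrite ?inE // /f' eqxx.
  - by rewrite !inE => xl ->; exists x; rewrite ?inE // /f' (negbTE xl).
  - rewrite /f'; case: (x =P l) => [_|/eqP xl]; first by left.
    by right; rewrite imset_f // !inE.
apply: E_copy.
  have nu x : x != l -> f x <> u by move=> xl e; case/negP: un;
    rewrite -e imset_f // !inE.
  move=> x y; rewrite /f'; case: (x =P l) => [->|/eqP xl]; case: (y =P l) =>
    [->|/eqP yl] //.
  - by move=> /esym /(nu _ yl).
  - by move=> /(nu _ xl).
  - by apply: f_inj; rewrite !inE.
move=> x y; rewrite /f'; case: (x =P l) => [->|/eqP xl]; case: (y =P l) => [->|/eqP yl].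
- by rewrite t_irr.
- by rewrite t_sym => /hl ->; rewrite [g u _]g_sym [h u _]h_sym.
- by move/hl => ->.
- by move=> txy; rewrite fh ?orbT // !inE.
Qed.

Definition slot (B : {set V}) (x : U) := chunk B (#|B| %/ k) (enum_rank x).

Lemma slot_disjoint (B : {set V}) x y : x != y -> [disjoint slot B x & slot B y].
Proof.
by move=> xy; apply: chunk_disjoint; apply: contra xy => /eqP/val_inj/enum_rank_inj ->.
Qed.

Lemma slot_sub (B : {set V}) x : slot B x \subset B.
Proof. exact: chunk_sub. Qed.

Lemma slot_large (B : {set V}) x : k * (k.+2 * n) + N * k <= N * #|B| ->
  k.+2 * n <= N * #|slot B x|.
Proof.
move=> hB; have k_gt0 : 0 < k by apply: ltn_trans k_gt1.
have s_gt0 : 0 < #|B| %/ k.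
  by rewrite divn_gt0 // -(leq_pmul2l N_gt0); apply: leq_trans hB; apply: leq_addl.
rewrite card_chunk //; last first.
  by apply: leq_trans (leq_divM #|B| k); rewrite mulnC leq_mul2l; case: enum_rank =>
    i /= ->; rewrite orbT.
rewrite -(leq_pmul2l k_gt0); have := ltn_ceil #|B| k_gt0; move: hB N_gt0.
by move: (k.+2 * n) #|B| (#|B| %/ k) => a b s; clear; nia.
Qed.

Lemma embedding_inj (S : {set U}) (f : U -> V) (A : U -> {set V}) :
  (forall x y, x != y -> [disjoint A x & A y]) ->
  (forall x, x \in S -> f x \in A x) -> {in S &, injective f}.
Proof.
move=> dA fA x y xS yS e; apply/eqP; apply: contraT => xy.
by have := disjointFr (dA _ _ xy) (fA _ xS); rewrite e fA.
Qed.

Hypothesis q_gt0 : 0 < q.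
Let nb u := [set x | g u x].
Hypothesis nb_large : forall u, n <= q * #|nb u|.

Let fits b (B : {set V}) : n <= b * #|B| -> 2 * b * (k * k.+2) <= N ->
  k * (k.+2 * n) + N * k <= N * #|B|.
Proof.
move=> hB hN; have h1 : k * (k.+2 * n) + N * k <= 2 * (k * k.+2) * n.
  have : N * k <= k * k.+2 * n by rewrite mulnC leq_mul // leq_pmulr.
  by rewrite mulnA; clear; lia.
apply: leq_trans h1 _; apply: leq_trans (leq_mul hN (leqnn #|B|)).
by move: hB; move: (k * k.+2) => c; clear; nia.
Qed.

(** Each vertex of [X] has n / (2 q) neighbours outside [W]. By averaging, n / (4 q) vertices see a
    share 1 / (4 q) of [X] each. The tree without its leaf is embedded among them, and the image of
    [p] accepts as leaf whatever it sees. *)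
Lemma trees_completable : 8 * q * (k * k.+2) <= N -> completable E k (2 * q) (4 * q).
Proof.
move=> hN W X hW X0.
pose A := [set a | (a \notin W) && (#|X| <= 4 * q * #|nb a :&: X|)].
have X_gt0 : 0 < #|X| by rewrite card_gt0.
have cA : n <= 4 * q * #|A|.
  have h1 : \sum_(u in X) n <= \sum_(u in X) 2 * q * #|nb u :\: W|.
    apply: leq_sum => u _; have := card_setD_ge (nb u) W; move: (nb_large u) hW q_gt0.
    by rewrite -/n; clear; nia.
  have h2 : \sum_(u in X) #|nb u :\: W| = \sum_(a in ~: W) #|nb a :&: X|.
    under eq_bigr do rewrite -sum1_card.
    under [RHS]eq_bigr do rewrite -sum1_card.
    rewrite (exchange_big_dep (mem (~: W))) /=; last by move=> x u _; rewrite !inE =>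
      /andP[].
    apply: eq_bigr => a aW; apply: eq_bigl => x; move: aW.
    by rewrite !inE => ->; rewrite g_sym andbC.
  have h3 : 4 * q * \sum_(a in ~: W) #|nb a :&: X| <= 4 * q * (#|A| * #|X|) + n * #|X|.
    rewrite (bigID (mem A)) /= mulnDr leq_add //.
      rewrite leq_mul2l -sum_nat_const; apply/orP; right.
      rewrite [X in X <= _](eq_bigl (mem A)); last first.
        by move=> a; rewrite !inE; case: (a \in W).
      by apply: leq_sum => a _; apply: subset_leq_card; apply: subsetIr.
    rewrite big_distrr /=; apply: leq_trans (_ : \sum_(a : V) #|X| <= _);
      last by rewrite sum_nat_const.
    rewrite big_mkcond /=; apply: leq_sum => a _; case: ifP => //.
    by rewrite !inE => /andP[-> /=]; rewrite -ltnNge => /ltnW.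
  move: h1 h3; rewrite -big_distrr /= h2 sum_nat_const.
  move: (\sum_(a in ~: W) _) => a h1 h3; rewrite -(leq_pmul2r X_gt0).
  by move: h1 h3; clear; nia.
have [l [p [S [gS eS pS hl]]]] := leaf_exists.
have [||f [fA fh]] := grown_embedding (A := slot A) gS.
- exact: slot_disjoint.
- move=> x _; have cx : k.+2 * n <= N * #|slot A x|.
    by apply: slot_large; apply: (fits cA); rewrite [2 * _]mulnA.
  apply: leq_trans cx; rewrite leq_mul2r; apply/orP; right.
  by apply: leq_trans (max_card _) _; rewrite -addn2 leq_addr.
have f_inj : {in S &, injective f} by apply: embedding_inj fA; apply: slot_disjoint.
have fA' x : x \in S -> f x \in A by move/fA; apply: (subsetP (slot_sub A x)).
exists (f @: S); split.
- by rewrite card_in_imset // eS cardsC1.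
- apply: disjoint_of_mem => v; apply/negP => /andP[/imsetP[x /fA' + ->]].
  by rewrite inE => /andP[/negbTE ->].
have := fA' p pS; rewrite inE => /andP[_ hX].
apply: leq_trans hX _; rewrite leq_mul2l; apply/orP; right.
apply/subset_leq_card/subsetP => u; rewrite !inE => /andP[gu uX]; rewrite uX /=.
have [//|un] := boolP (u \in _); rewrite /= eS in un *.
by apply: (leaf_completed (p := p)) => //; rewrite ?gu -?eS.
Qed.

(** The switch is a copy of the tree without its leaf, with [p] placed at a vertex that has
    [h]-neighbours in both [Y] and [Y']; either neighbour serves as the leaf. *)
Lemma trees_exchangeable d : 3 < d -> 8 * d * (k * k.+2) <= N ->
  exchangeable E (2 * q) d k.
Proof.
move=> d_gt3 hN W Y Y' hW hY hY' dY dY'.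
have kk : 1 < k * k.+2 by move: k_gt1; clear; nia.
set s := n %/ (2 * d).
have d2 : 0 < 2 * d by move: d_gt3; clear; lia.
have s_gt0 : 0 < s by rewrite divn_gt0 //; apply: leq_trans N_le_n; move: hN kk;
  clear; nia.
have hs : s * (2 * d) <= n by apply: leq_divM.
have hNs : n <= N * s.
  have := ltn_ceil n d2; rewrite -/s; move: hN kk s_gt0; clear; nia.
pose T1 := chunk Y s 0.
have sT1 : T1 \subset Y by apply: chunk_sub.
have cT1 : #|T1| = s by rewrite card_chunk // mul1n; move: hs hY d_gt3; rewrite -/n;
  clear; nia.
pose T2 := chunk (Y' :\: T1) s 0.
have sT2 : T2 \subset Y' :\: T1 by apply: chunk_sub.
have cT2 : #|T2| = s.
  rewrite card_chunk // mul1n; have := card_setD_ge Y' T1; rewrite cT1.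
  by move: hs hY' d_gt3; rewrite -/n; clear; nia.
pose B := ~: (W :|: (T1 :|: T2)).
have cB : n <= 4 * #|B|.
  have := cardsC (W :|: (T1 :|: T2)); rewrite -/B -/n.
  have := card_setU_le W (T1 :|: T2); have := card_setU_le T1 T2; rewrite cT1 cT2.
  have : 2 * #|W| <= n by move: hW q_gt0; rewrite -/n; clear; nia.
  by move: hs d_gt3; clear; nia.
have [l [p [S [gS eS pS hl]]]] := leaf_exists.
pose Bp := [set v in slot B p | [exists y in T1, h v y] && [exists y in T2, h v y]].
pose A x := if x == p then Bp else slot B x.
have sA x : A x \subset slot B x.
  by rewrite /A; case: eqP => // ->; apply/subsetP => v; rewrite inE => /andP[].
have miss (T : {set V}) : n <= N * #|T| -> [disjoint T & B] ->
    N * #|slot B p :\: [set v | [exists y in T, h v y]]| < n.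
  move=> cT dT; rewrite ltnNge; apply/negP => big.
  have [|a [b [+ bT hab]]] := spread_edge hS _ big cT.
    rewrite disjoint_sym; apply: disjointWr dT.
    by apply: subset_trans (slot_sub B p); apply: subsetDl.
  rewrite inE => /andP[/negP[]].
  by rewrite inE; apply/exists_inP; exists b.
have hslot x : k.+2 * n <= N * #|slot B x|.
  apply: slot_large => //; apply: (fits cB); apply: leq_trans hN.
  by rewrite leq_mul2r; apply/orP; right; move: d_gt3; clear; lia.
(* The 2 in [k.+2] pays for the vertices of the slot of [p] without a neighbour in [T1], or without
   one in [T2]: fewer than n / N each. *)
have cBp : k * n <= N * #|Bp|.
  have m1 := miss T1; have m2 := miss T2; rewrite cT1 in m1; rewrite cT2 in m2.
  have d1 : [disjoint T1 & B] by rewrite /B; set_solve.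
  have d2' : [disjoint T2 & B] by rewrite /B; set_solve.
  have {}m1 := m1 hNs d1; have {}m2 := m2 hNs d2'.
  set M1 := [set v | _] in m1; set M2 := [set v | _] in m2.
  have : #|slot B p| <= #|Bp| + #|slot B p :\: M1| + #|slot B p :\: M2|.
    apply: leq_trans (_ : #|(Bp :|: (slot B p :\: M1)) :|: (slot B p :\: M2)| <= _).
      apply/subset_leq_card/subsetP => v vs; rewrite !in_setU !in_setD vs !andbT.
      rewrite [v \in Bp]in_set vs [v \in M1]in_set [v \in M2]in_set /=.
      by case: [exists _ in T1, _]; case: [exists _ in T2, _].
    by apply: leq_trans (card_setU_le _ _) _; rewrite leq_add2r card_setU_le.
  move=> hc; have := leq_trans (hslot p) (leq_mul (leqnn N) hc).
  by rewrite !mulnDr; move: m1 m2; clear; lia.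
have [||f [fA fh]] := grown_embedding (A := A) gS.
- by move=> x y xy; apply: disjointWl (sA x) (disjointWr (sA y) (slot_disjoint B xy)).
- move=> x _; apply: leq_trans (_ : k * n <= _);
  first by rewrite leq_mul2r max_card orbT.
  rewrite /A; case: eqP => // _; apply: leq_trans (hslot x).
  by rewrite leq_mul2r -addn2 leq_addr orbT.
have f_inj : {in S &, injective f}.
  apply: embedding_inj fA => x y xy.
  by apply: disjointWl (sA x) (disjointWr (sA y) (slot_disjoint B xy)).
have fB x : x \in S -> f x \in B.
  by move/fA/(subsetP (sA x)); apply: (subsetP (slot_sub B x)).
have dRB : f @: S \subset B by apply/subsetP => v /imsetP[x /fB + ->].
have := fA p pS; rewrite /A eqxx inE =>
  /and3P[_ /exists_inP[y yT hy] /exists_inP[y' y'T hy']].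
have yR : y \notin f @: S.
  by apply/negP => /(subsetP dRB); rewrite in_setC !in_setU yT orbT.
have y'R : y' \notin f @: S.
  by apply/negP => /(subsetP dRB); rewrite in_setC !in_setU y'T !orbT.
exists y, y', (f @: S); split; split=> //.
- exact: (subsetP sT1).
- by have := subsetP sT2 _ y'T; rewrite in_setD => /andP[].
- apply: contraTneq y'T => <-; apply/negP => /(subsetP sT2).
  by rewrite in_setD yT.
- by apply: leq_trans (leq_imset_card _ _) (max_card _).
- apply: disjointWl dRB _; rewrite /B; set_solve.
- by split; apply: tiled1; rewrite eS; apply: (leaf_completed (p := p));
  rewrite -?eS ?hy ?hy' ?orbT.
Qed.

(** As long as more than n / d vertices are uncovered, [h] alone embeds another copy among them. *)
Lemma trees_nearly_tileable d w : 0 < d -> 2 * d * (k * k.+2) <= N ->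
  nearly_tileable E w d.
Proof.
move=> d_gt0 hN W _.
suff: forall b X, tiled E X -> [disjoint X & W] -> n - #|X| <= b ->
    exists X, [/\ tiled E X, [disjoint X & W] & d * #|~: (X :|: W)| <= n].
  by move/(_ n set0); apply; [exact: tiled0 | set_solve | rewrite leq_subr].
elim=> [|b IH] X tX dX hb.
all: have [?|hL] := leqP (d * #|~: (X :|: W)|) n; first by exists X.
all: set L := ~: (X :|: W) in hL.
all: have cx x : k.+2 * n <= N * #|slot L x| by
  apply: slot_large; apply: fits hN; exact: ltnW.
all: have [||f [fA fh]] := grown_embedding (A := slot L) t_grown.
all: try exact: slot_disjoint.
all: try by move=> x _; apply: leq_trans (cx x);
  rewrite leq_mul2r cardsT -/k -addn2 leq_addr orbT.
all: have f_inj : injective f by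
  move=> x y e; apply: (embedding_inj (@slot_disjoint L) fA) => //; rewrite inE.
all: have fL : f @: [set: U] \subset L by
  apply/subsetP => v /imsetP[x _ ->]; apply: (subsetP (slot_sub L x)); apply: fA;
    rewrite inE.
all: have fE : f @: [set: U] \in E by
  apply: E_copy => // x y txy; rewrite fh ?orbT ?inE.
all: have cf : #|f @: [set: U]| = k by rewrite card_imset // cardsT.
all: have d1 : [disjoint f @: [set: U] & X] by rewrite /L in fL; set_solve.
all: have cXf : #|f @: [set: U] :|: X| = k + #|X| by rewrite card_disjointU // cf.
all: have cn : #|f @: [set: U] :|: X| <= n by apply: max_card.
- by move: hb cn k_gt1; rewrite cXf; clear; lia.
- apply: (IH (f @: [set: U] :|: X)).
  + exact: tiled_add.
  + by rewrite /L in fL; set_solve.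
  + by move: hb cn k_gt1; rewrite cXf; clear; lia.
Qed.

End Trees.

(** * Factors in the union of two graphs *)

Section GraphFacts.
Variable V : finType.
Implicit Types G H : sgraph V.

Lemma adj_sym G : symmetric (adj G).
Proof. by move=> x y; rewrite /adj finset.setUC. Qed.

Lemma adj_irr G : irreflexive (adj G).
Proof.
move=> x; apply/negP => /(forall_inP (edges_card2 G)).
by rewrite finset.setUid cards1.
Qed.

Lemma adj_gunion G H x y : adj (gunion G H) x y = adj G x y || adj H x y.
Proof. by rewrite /adj inE. Qed.

Lemma min_deg_le G x : min_deg G <= deg G x.
Proof.
rewrite /min_deg; have := mem_index_enum x.
elim: (index_enum V) => [|y r IH] //; rewrite inE big_cons => /orP[/eqP <-|/IH].
  exact: geq_minl.
by apply: leq_trans; apply: geq_minr.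
Qed.

End GraphFacts.

Lemma path_exit (U : finType) (e : rel U) (S : {set U}) w p :
  path e w p -> w \in S -> last w p \notin S ->
  exists a b, [/\ a \in S, b \notin S & e a b].
Proof.
elim: p w => [|x p IH] w /=; first by move=> _ ->.
move=> /andP[ewx px] wS; have [xS|xS] := boolP (x \in S); first exact: IH.
by exists w, x.
Qed.

(** * Leaf orders of trees *)

Section TreeOrder.
Variables (U : finType) (T : sgraph U).
Hypothesis tree_T : is_tree T.

Definition adj_in (S : {set U}) : rel U :=
  fun a b => [&& adj T a b, a \in S & b \in S].

Lemma grown_connected (S : {set U}) : grown (adj T) S ->
  {in S &, forall a b, connect (adj_in S) a b}.
Proof.
elim=> [x a b|{}S x y gS IH yS xS tyx _ a b].
  by rewrite !inE => /eqP -> /eqP ->; apply: connect0.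
have sub : subrel (connect (adj_in S)) (connect (adj_in (x |: S))).
  apply: connect_sub => c d /and3P[cd cS dS]; apply: connect1.
  by rewrite /adj_in cd !inE cS dS !orbT.
have xy : connect (adj_in (x |: S)) x y.
  by apply: connect1; rewrite /adj_in adj_sym tyx !inE eqxx yS orbT.
have yx : connect (adj_in (x |: S)) y x.
  by apply: connect1; rewrite /adj_in tyx !inE eqxx yS orbT.
rewrite !inE => /orP[/eqP ->|aS] /orP[/eqP ->|bS].
- exact: connect0.
- by apply: connect_trans xy (sub _ _ (IH _ _ yS bS)).
- by apply: connect_trans (sub _ _ (IH _ _ aS yS)) yx.
- exact: sub (IH _ _ aS bS).
Qed.

(* A second neighbour in S of the new vertex would close a cycle through S. *)
Lemma grown_extend (S : {set U}) : grown (adj T) S -> S != [set: U] ->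
  exists2 x, x \notin S & grown (adj T) (x |: S).
Proof.
move=> gS ST; have [conn acyc] := tree_T.
have [w wS] : exists w, w \in S by case: gS => [x|S' x *]; exists x; rewrite !inE eqxx.
have [z zS] : exists z, z \notin S.
  by move: ST; rewrite -finset.subTset => /subsetPn[z _]; exists z.
have /connectP[p pth ez] := conn w z; rewrite ez in zS.
have [a [b [aS bS ab]]] := path_exit pth wS zS.
exists b => //; apply: (grown_add gS aS bS ab) => c cS cb; apply/eqP.
apply: contraT => ca; have /connectP[q qth ea] := grown_connected gS cS aS.
have [q' [q'th uq' eq']] : exists q',
  [/\ path (adj_in S) c q', uniq (c :: q') & last c q' = a].
  by case/shortenP: qth ea => q' ? ? _ ->; exists q'.
have inS x : x \in c :: q' -> x \in S.
  rewrite inE => /orP[/eqP -> //|].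
  elim: q' c {cS cb ca qth ea uq' eq'} q'th =>
    [|y q' IH] //= c /andP[/and3P[_ _ yS] th].
  by rewrite inE => /orP[/eqP ->|] //; apply: IH th.
(* The cycle through [b], [c] and on to [a] would have length less than 3, so [q'] is empty and c =
   a. *)
have := acyc (b :: c :: q'); rewrite /ucycle /ucycleb.
have -> : cycle (adj T) (b :: c :: q').
  rewrite /= adj_sym cb rcons_path eq' ab andbT.
  by apply: sub_path q'th => x y /and3P[].
rewrite cons_uniq uq' andbT /= => /(_ _) h; have : size q' < 1.
  by apply: h; apply: contra bS; apply: inS.
by case: (q') eq' => //= ec; rewrite ec eqxx in ca.
Qed.

Lemma tree_grown : 0 < #|U| -> grown (adj T) [set: U].
Proof.
case/card_gt0P => r _.
suff: forall m (S : {set U}), #|~: S| <= m -> grown (adj T) S -> grown (adj T) [set: U].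
  by move/(_ _ _ (leqnn _) (grown1 _ r)).
elim=> [|m IH] S cS gS.
  by move: cS; rewrite leqn0 cards_eq0 -(inj_eq (@finset.setC_inj U)) finset.setCK
    finset.setC0 => /eqP <-.
have [<- //|ST] := eqVneq S [set: U].
have [x xS gxS] := grown_extend gS ST; apply: IH gxS.
rewrite finset.setCU; move: cS; rewrite (cardsD1 x) inE xS.
by rewrite finset.setDE finset.setIC.
Qed.

End TreeOrder.

(** * From tilings to factors *)

Section Glue.
Variables (U V : finType) (F : sgraph U) (H : sgraph V).

Definition copies : {set {set V}} :=
  [set f @: [set: U] | f : {ffun U -> V} & is_copy F H f].

Lemma copies_card e : e \in copies -> #|e| = #|U|.
Proof.
case/imsetP => f; rewrite inE => /andP[/injectiveP f_inj _] ->.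
by rewrite card_imset // cardsT.
Qed.

Lemma copies_of_embedding (f : U -> V) : injective f ->
  (forall x y, adj F x y -> adj H (f x) (f y)) -> f @: [set: U] \in copies.
Proof.
move=> f_inj fh; apply/imsetP; exists (finfun f).
  rewrite inE; apply/andP; split.
    by apply/injectiveP => x y; rewrite !ffunE; apply: f_inj.
  by apply/forallP => x; apply/forallP => y; apply/implyP; rewrite !ffunE; apply: fh.
by apply: eq_imset => x; rewrite ffunE.
Qed.

Lemma tiled_factor (X : {set V}) : tiled copies X ->
  exists S : {set {ffun U -> V}},
    [/\ forall f, f \in S -> is_copy F H f,
      forall f f', f \in S -> f' \in S -> f != f' -> [disjoint codom f & codom f'],
      forall f, f \in S -> {subset codom f <= X} &
      forall v, v \in X -> exists2 f, f \in S & v \in codom f].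
Proof.
elim=> [|{}X e eE d tX [S [cS dS sS vS]]].
  by exists finset.set0; split=> f; rewrite inE.
case/imsetP: eE => f; rewrite inE => cf ee.
have ce v : v \in codom f = (v \in e).
  rewrite ee; apply/codomP/imsetP => [[x ->]|[x _ ->]]; first by exists x.
  by exists x.
have df f' : f' \in S -> [disjoint codom f & codom f'].
  move=> f'S; rewrite disjoint_subset; apply/subsetP => v; rewrite ce !inE => ve.
  by apply/negP => /(sS _ f'S); rewrite (disjointFr d ve).
exists (f |: S); split.
- by move=> f'; rewrite !inE => /orP[/eqP ->|/cS].
- move=> f1 f2; rewrite !inE => /orP[/eqP ->|f1S] /orP[/eqP ->|f2S];
  first by rewrite eqxx.
  + by move=> _; apply: df.
  + by move=> _; rewrite disjoint_sym; apply: df.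
  + exact: dS.
- move=> f'; rewrite !inE => /orP[/eqP ->|f'S] v; rewrite inE; first by rewrite ce =>
  ->.
  by move/(sS _ f'S) => ->; rewrite orbT.
- move=> v; rewrite !inE => /orP[ve|/vS[f' f'S vf']].
    by exists f; rewrite ?ce // !inE eqxx.
  by exists f'; rewrite // !inE f'S orbT.
Qed.

Lemma tiled_has_factor : tiled copies [set: V] -> has_factor F H.
Proof.
case/tiled_factor => S [cS dS _ vS]; apply/existsP; exists S; apply/and3P; split.
- by apply/forall_inP.
- by apply/forall_inP => f fS; apply/forall_inP => f' f'S; apply/implyP; apply: dS.
- by apply/forallP => v; have [f fS vf] := vS v (finset.in_setT v); apply/exists_inP;
  exists f.
Qed.

End Glue.

Lemma copies_of_cycle (V : finType) k (H : sgraph V) c : 0 < k -> uniq c ->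
  size c = k ->
  cycle (adj H) c -> [set x in c] \in copies (cycle_graph k) H.
Proof.
move=> k_gt0 uc sc; case: c uc sc => [|x0 p] uc sc; first by rewrite -sc in k_gt0.
move=> cyc; pose f (i : 'I_k) := nth x0 (x0 :: p) i.
have next (i : 'I_k) : adj H (f i) (f (ordS i)).
  have szp : size p = k.-1 by rewrite -sc.
  have /pathP-/(_ x0 i) := cyc; rewrite size_rcons szp prednK // => /(_ (ltn_ord i)).
  rewrite /f /= -rcons_cons nth_rcons sc ltn_ord.
  rewrite nth_rcons szp; have := ltn_ord i;
    rewrite -[X in _ < X](prednK k_gt0) ltnS leq_eqVlt.
  case/orP=> [/eqP ei|lt_i].
    by rewrite ei ltnn eqxx prednK // modnn.
  by rewrite lt_i modn_small // -ltn_predRL.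
have -> : [set x in x0 :: p] = f @: [set: 'I_k].
  apply/setP => v; rewrite in_set; apply/idP/imsetP => [vp|[i _ ->]].
    have lt_v : index v (x0 :: p) < k by rewrite -sc index_mem.
    by exists (Ordinal lt_v); rewrite // /f nth_index.
  by rewrite mem_nth // sc.
apply: copies_of_embedding.
  by move=> i j /eqP; rewrite /f nth_uniq ?sc // => /eqP/val_inj.
move=> i j; rewrite /adj inE => /andP[cij
  /existsP[x /existsP[y /andP[/eqP -> /eqP e]]]].
have ij : i != j by move: cij; rewrite cards2; case: (i != j).
have : i \in [set x; ordS x] by rewrite -e !inE eqxx.
have : j \in [set x; ordS x] by rewrite -e !inE eqxx orbT.
rewrite !inE => /orP[] /eqP ej /orP[] /eqP ei; move: ij; rewrite ei ej ?eqxx // => _.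
- by rewrite -/(adj H _ _) adj_sym.
- exact: next.
Qed.

Lemma completable_weaken (V : finType) (E : {set {set V}}) k w w' c : w <= w' ->
  completable E k w c -> completable E k w' c.
Proof.
by move=> le_w h W U hW; apply: h; apply: leq_trans hW; rewrite leq_mul2r le_w orbT.
Qed.

Lemma exchangeable_weaken (V : finType) (E : {set {set V}}) w w' g r : w <= w' ->
  exchangeable E w g r -> exchangeable E w' g r.
Proof.
by move=> le_w h W Y Y' hW; apply: h; apply: leq_trans hW; rewrite leq_mul2r le_w orbT.
Qed.

(** The constant compares the upper bound 4 p n^2 for all edges of G(n,p) with the lower bound p n^2
    / (8 N^2) for those between two sets of size n / N. *)
Definition all_spread (V : finType) (e : rel V) (Ns : seq nat) :=
  {in Ns, forall N, spread e N (32 * (N * N))}.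

(** [N1] serves completions and leads to [d]; [N2] then serves exchanges and almost tilings at share
    1 / d. *)
Theorem tree_factor (k q : nat) : 1 < k -> 0 < q ->
  exists Ns n0, all (leq 1) Ns /\ forall n (G H : sgraph 'I_n) (T : sgraph 'I_k),
    n0 <= n -> k %| n -> all_spread (adj H) Ns -> n <= q * min_deg G -> is_tree T ->
    has_factor T (gunion G H).
Proof.
move=> k_gt1 q_gt0; set kk := k * k.+2.
have kk_gt0 : 0 < kk by rewrite muln_gt0 (ltn_trans _ k_gt1).
have [||d [n0 [d_gt3 habs]]] := @absorption k (2 * q) (4 * q) k k_gt1.
- by move: q_gt0; clear; lia.
- by rewrite muln_gt0.
pose N1 := 8 * q * kk; pose N2 := 8 * d * kk.
have N1_gt0 : 0 < N1 by rewrite /N1 2!muln_gt0 q_gt0 kk_gt0.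
have N2_gt0 : 0 < N2 by rewrite /N2 2!muln_gt0 (ltn_trans _ d_gt3) ?kk_gt0.
exists [:: N1; N2], (n0 + N1 + N2); split; first by rewrite /= N1_gt0 N2_gt0.
move=> n G H T n_large kn hS hG treeT.
have s1 : spread (adj H) N1 (32 * (N1 * N1)) by apply: hS; rewrite !inE eqxx.
have s2 : spread (adj H) N2 (32 * (N2 * N2)) by apply: hS; rewrite !inE eqxx orbT.
have nb u : #|'I_n| <= q * #|[set x | adj G u x]|.
  by rewrite card_ord; apply: leq_trans hG _; rewrite leq_mul2l min_deg_le orbT.
have kI : 1 < #|'I_k| by rewrite card_ord.
have gT : grown (adj T) [set: 'I_k] by apply: tree_grown => //; apply: ltnW.
have copy (f : 'I_k -> 'I_n) : injective f ->
    (forall x y, adj T x y -> adj G (f x) (f y) || adj H (f x) (f y)) ->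
    f @: [set: 'I_k] \in copies T (gunion G H).
  by move=> f_inj fh; apply: copies_of_embedding => // x y /fh; rewrite adj_gunion.
have [tS tI] := (@adj_sym _ T, @adj_irr _ T).
have [gS hSym] := (@adj_sym _ G, @adj_sym _ H).
have le1 : N1 <= #|'I_n| by rewrite card_ord; apply: leq_trans n_large; clear; lia.
have le2 : N2 <= #|'I_n| by rewrite card_ord; apply: leq_trans n_large; clear; lia.
apply: tiled_has_factor; apply: habs.
- by rewrite card_ord; apply: leq_trans n_large; clear; lia.
- by rewrite card_ord.
- by move=> e /copies_card; rewrite card_ord.
- have := @trees_completable _ _ _ _ _ _ _ _ q kI tS tI gS hSym copy s1 gT N1_gt0 le1
  q_gt0 nb.
  by rewrite card_ord; apply.
- have := @trees_exchangeable _ _ _ _ _ _ _ _ q kI tS tI gS hSym copy s2 gT N2_gt0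
  le2 q_gt0.
  by rewrite card_ord; apply.
- have := @trees_nearly_tileable _ _ _ _ _ _ _ _ kI tS tI hSym copy s2 gT N2_gt0 le2 d.
  rewrite card_ord; apply; first by apply: ltn_trans d_gt3.
  by rewrite leq_mul2r (leq_mul2r d 2 8) /= !orbT.
Qed.

(** [N1] serves completions; its constant [K1] leads to [d]. [N2] serves the edges into sets of
    share 1 / d; its constant [K2] determines how small common neighbourhoods may be, and [N3] finds
    paths inside them. [N4] finds the paths that enlarge a partial tiling. The degree condition is
    that of n / k + n / q. *)
Theorem cycle_factor (k q : nat) : 3 < k -> 0 < q ->
  exists Ns n0, all (leq 1) Ns /\ forall n (G H : sgraph 'I_n),
    n0 <= n -> k %| n -> all_spread (adj H) Ns ->
    (q + k) * n <= k * q * min_deg G ->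
    has_factor (cycle_graph k) (gunion G H).
Proof.
move=> k_gt3 q_gt0; have k_gt0 : 0 < k by apply: ltn_trans k_gt3.
pose M1 := 16 * q + k; pose N1 := k * (16 * q * M1); pose K1 := 32 * (N1 * N1).
have M1_gt0 : 0 < M1 by rewrite addn_gt0 k_gt0 orbT.
have N1_gt0 : 0 < N1 by rewrite /N1 3!muln_gt0 k_gt0 q_gt0 M1_gt0.
have K1_gt0 : 0 < K1 by rewrite /K1 2!muln_gt0 N1_gt0.
have [|||d [n0 [d_gt3 habs]]] := @absorption k (4 * q) (2 ^ M1 * K1) (3 * k).
- by apply: ltn_trans k_gt3.
- by move: q_gt0; clear; lia.
- by rewrite muln_gt0 expn_gt0 K1_gt0.
have d_gt0 : 0 < d by apply: ltn_trans d_gt3.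
pose M2 := 16 * (q + d); pose N2 := 32 * q * M2; pose K2 := 32 * (N2 * N2).
have M2_gt0 : 0 < M2 by rewrite /M2 muln_gt0 addn_gt0 q_gt0.
have N2_gt0 : 0 < N2 by rewrite /N2 2!muln_gt0 q_gt0 M2_gt0.
have K2_gt0 : 0 < K2 by rewrite /K2 2!muln_gt0 N2_gt0.
pose N3 := 4 * 2 ^ M2 * (K2 * K2) * (k * k).
have kk_gt0 : 0 < k * k by rewrite muln_gt0 k_gt0.
have KK_gt0 : 0 < K2 * K2 by rewrite (muln_gt0 K2) K2_gt0.
have N3_gt0 : 0 < N3.
  by rewrite /N3 (muln_gt0 (_ * _ * _)) (muln_gt0 (_ * _)) (muln_gt0 4) expn_gt0
    KK_gt0 kk_gt0.
pose N4 := 8 * q * d * (k * k).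
have N4_gt0 : 0 < N4 by rewrite /N4 (muln_gt0 (_ * _)) kk_gt0 2!muln_gt0 q_gt0 d_gt0.
exists [:: N1; N2; N3; N4],
  (n0 + (4 * q * M1).+1 + (4 * q * M2).+1 + N3 * (4 * k + 6) + 2 * (k * N4)).
split; first by rewrite /= N1_gt0 N2_gt0 N3_gt0 N4_gt0.
move=> n G H n_large kn hS hG.
have s1 : spread (adj H) N1 K1 by apply: hS; rewrite !inE eqxx.
have s2 : spread (adj H) N2 K2 by apply: hS; rewrite !inE eqxx ?orbT.
have s3 : spread (adj H) N3 (32 * (N3 * N3)) by apply: hS; rewrite !inE eqxx ?orbT.
have s4 : spread (adj H) N4 (32 * (N4 * N4)) by apply: hS; rewrite !inE eqxx ?orbT.
have eN1 : N1 = k * (16 * q * M1) by [].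
have eN3 : N3 = 4 * 2 ^ M2 * (K2 * K2) * (k * k) by [].
have eN4 : N4 = 8 * q * d * (k * k) by [].
clearbody N1 N3 N4.
have deg_nb u : (q + k) * #|'I_n| <= k * q * #|[set x | adj G u x]|.
  by rewrite card_ord; apply: leq_trans hG _; rewrite leq_mul2l min_deg_le orbT.
have nb u : #|'I_n| <= q * #|[set x | adj G u x]|.
  rewrite -(leq_pmul2l k_gt0) mulnA; apply: leq_trans (deg_nb u).
  by rewrite leq_mul2r leq_addl orbT.
have cyc (c : seq 'I_n) : uniq c -> size c = k ->
    cycle (fun x y => adj G x y || adj H x y) c ->
    [set x in c] \in copies (cycle_graph k) (gunion G H).
  move=> uc sc hc; apply: copies_of_cycle => //.
  by rewrite (eq_cycle (@adj_gunion _ G H)).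
have [gS hSym] := (@adj_sym _ G, @adj_sym _ H).
have le_w : 2 * q <= 4 * q by rewrite (leq_mul2r q 2 4) orbT.
have E_card e : e \in copies (cycle_graph k) (gunion G H) -> #|e| = k.
  by move/copies_card; rewrite card_ord.
have [n1 n2 n3 n4] : [/\ 4 * q * M1 < #|'I_n|, 4 * q * M2 < #|'I_n|,
    N3 * (4 * k + 6) <= #|'I_n| & 2 * (k * N4) <= #|'I_n|].
  by rewrite card_ord; split; apply: leq_trans n_large;
    move: (4 * q * M1) (4 * q * M2) (N3 * _) (k * N4) => *; lia.
apply: tiled_has_factor; apply: habs => //.
- by rewrite card_ord; apply: leq_trans n_large; rewrite -!addnA leq_addr.
- by rewrite card_ord.
- apply: completable_weaken le_w _.
  exact (cycles_completable k_gt3 cyc gS s1 q_gt0 nb (erefl M1) eN1 n1).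
- apply: exchangeable_weaken le_w _.
  by apply: (cycles_exchangeable k_gt3 cyc gS s2 q_gt0 nb d_gt0 (erefl M2) (erefl N2)
    s3 eN3).
- apply: (cycles_nearly_tileable k_gt3 cyc gS q_gt0 E_card d_gt0 s4 eN4) => //.
  by apply: leq_ltn_trans n1.
Qed.

(** * The binomial random graph *)

Local Open Scope ring_scope.

Section Gnp.
Variables (R : realType) (n : nat) (p : R).
Implicit Types (H : sgraph 'I_n) (A B : {set 'I_n}).

Lemma edges_pair H e : e \in edges H -> #|e| == 2.
Proof. exact: (forall_inP (edges_card2 H)). Qed.

(* The edges are independent, so a multiplicative weight has the product of its
   edgewise means as expectation. *)
Lemma gnp_mean_prod (a : {set 'I_n} -> R) :
  \sum_(H : sgraph 'I_n) gnp_mass p H * \prod_(e in edges H) a e =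
  \prod_(e : {set 'I_n} | #|e| == 2) (1 - p + p * a e).
Proof.
(* With the values 0 and 1 outside pairs, expanding the product over all families of subsets kills
   every family that is not a graph. *)
pose f (e : {set 'I_n}) := if #|e| == 2 then p * a e else 0.
pose g (e : {set 'I_n}) := if #|e| == 2 then 1 - p else 1.
rewrite [RHS]big_mkcond /=.
rewrite [RHS](eq_bigr (fun e => f e + g e)); last first.
  by move=> e _; rewrite /f /g; case: eqP; rewrite ?add0r // addrC.
rewrite bigA_distr /=.
rewrite [RHS](bigID (fun J : {set {set 'I_n}} => [forall e in J, #|e| == 2])) /=.
rewrite [X in _ = _ + X]big1 ?addr0; last first.
  move=> J /forall_inPn[e eJ e2]; rewrite (bigD1 e) //= eJ /f (negbTE e2).
  by rewrite mul0r.
rewrite (reindex_omap (@edges 'I_n) insub) /=; last first.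
  by move=> J hJ; rewrite insubT.
apply: eq_big => [H|H _].
  by rewrite edges_card2 /= valK eqxx.
rewrite /gnp_mass [X in X * _]big_mkcond [X in _ * X]big_mkcond -big_split /=.
apply: eq_bigr => e _; rewrite /f /g.
have := @edges_pair H e; case: (e \in edges H) => [->|_] //; rewrite mulr1 //.
Qed.

Hypothesis p01 : 0 <= p <= 1.

Lemma gnp_mass_ge0 H : 0 <= gnp_mass p H.
Proof.
by apply: prodr_ge0 => e _; case: ifP => _; move: p01 => /andP[? ?]; rewrite ?subr_ge0.
Qed.

Lemma gnp_total : \sum_(H : sgraph 'I_n) gnp_mass p H = 1.
Proof.
transitivity (\sum_(H : sgraph 'I_n) gnp_mass p H * \prod_(e in edges H) (1 : R)).
  by apply: eq_bigr => H _; rewrite big1 ?mulr1.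
by rewrite gnp_mean_prod big1 // => e _; rewrite mulr1 subrK.
Qed.

Lemma gnp_pr_le1 (P : pred (sgraph 'I_n)) : gnp_pr p P <= 1.
Proof.
rewrite -gnp_total /gnp_pr big_mkcond; apply: ler_sum => H _.
by case: ifP => // _; apply: gnp_mass_ge0.
Qed.

Lemma gnp_pr_mono (P Q : pred (sgraph 'I_n)) : (forall H, P H -> Q H) ->
  gnp_pr p P <= gnp_pr p Q.
Proof.
move=> PQ; rewrite /gnp_pr [leLHS]big_mkcond [leRHS]big_mkcond.
apply: ler_sum => H _; have := PQ H; case: (P H) => [->//|_].
by case: ifP => // _; apply: gnp_mass_ge0.
Qed.

Lemma gnp_markov (P : pred (sgraph 'I_n)) (f : sgraph 'I_n -> R) :
  (forall H, 0 <= f H) -> (forall H, ~~ P H -> 1 <= f H) ->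
  1 - \sum_(H : sgraph 'I_n) gnp_mass p H * f H <= gnp_pr p P.
Proof.
move=> f0 f1; rewrite lerBlDr -{1}gnp_total /gnp_pr.
rewrite (bigID P) /= lerD2l big_mkcond; apply: ler_sum => H _.
case: ifP => [nP|_]; last by rewrite mulr_ge0 ?gnp_mass_ge0.
by rewrite ler_peMr ?gnp_mass_ge0 ?f1.
Qed.

(** The upper bound is the square of e^(1/2) <= 2, which follows from e^(-1/2) >= 1 - 1/2. *)
Lemma expR1_bounds : 2 <= expR (1 : R) <= 4.
Proof.
apply/andP; split; first by have := expR_ge1Dx (1 : R); lra.
have h : expR (2^-1) <= 2 :> R.
  have := expR_ge1Dx (- 2^-1 : R); rewrite expRN => h.
  have y0 := expR_gt0 (2^-1 : R).
  have e : (expR 2^-1)^-1 * expR 2^-1 = 1 :> R by rewrite mulVf ?gt_eqF.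
  nra.
have -> : expR 1 = expR (2^-1) * expR (2^-1) :> R by rewrite -expRD; congr expR; lra.
have := expR_gt0 (2^-1 : R); nra.
Qed.

Lemma card_pairs_le : (#|[pred e : {set 'I_n} | #|e| == 2]| <= n * n)%N.
Proof.
have -> : #|[pred e : {set 'I_n} | #|e| == 2]| = #|[set e : {set 'I_n} | #|e| == 2]|.
  by apply: eq_card => e; rewrite !inE.
rewrite card_draws card_ord bin2.
apply: leq_trans (half_leq (leq_mul (leqnn n) (leq_pred n))) _; lia.
Qed.

(** A pair contributes 1 + p (e - 1) <= 1 + 3 p <= e^(3 p), by e <= 4. *)
Lemma mean_expR_edges :
  \sum_(H : sgraph 'I_n) gnp_mass p H * expR (#|edges H|%:R) <=
    expR (3 * p * (n * n)%:R).
Proof.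
have [p0 p1] := andP p01; have [e2 e4] := andP expR1_bounds.
rewrite (eq_bigr (fun H => gnp_mass p H * \prod_(e in edges H) expR 1)); last first.
  by move=> H _; rewrite prodr_const -expRM_natr mul1r.
rewrite gnp_mean_prod; apply: le_trans
  (_ : \prod_(e : {set 'I_n} | #|e| == 2) expR (3 * p) <= _).
  apply: ler_prod => e _; apply/andP; split; first by nra.
  apply: le_trans (expR_ge1Dx _); nra.
rewrite prodr_const -expRM_natr ler_expR ler_wpM2l ?mulr_ge0 //.
by rewrite ler_nat card_pairs_le.
Qed.

Definition crossing A B := [set [set q.1; q.2] | q in finset.setX A B].

Lemma crossing_inj A B : [disjoint A & B] ->
  {in finset.setX A B &, injective (fun q : 'I_n * 'I_n => [set q.1; q.2])}.
Proof.
move=> d [a b] [a' b']; rewrite !inE /= => /andP[aA bB] /andP[a'A b'B] e.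
have : a \in [set a'; b'] by rewrite -e !inE eqxx.
have : b \in [set a'; b'] by rewrite -e !inE eqxx orbT.
rewrite !inE => /orP[/eqP eb|/eqP ->]; first by rewrite eb (disjointFr d a'A) in bB.
by move=> /orP[/eqP ->|/eqP ea] //; rewrite ea (disjointFl d b'B) in aA.
Qed.

Lemma card_crossing A B : [disjoint A & B] -> #|crossing A B| = (#|A| * #|B|)%N.
Proof. by move=> d; rewrite card_in_imset ?cardsX //; apply: crossing_inj. Qed.

Lemma crossing_pair A B e : [disjoint A & B] -> e \in crossing A B -> #|e| == 2.
Proof.
move=> d /imsetP[[a b]]; rewrite inE /= => /andP[aA bB] ->.
by rewrite cards2 /=; case: (a =P b) => // ab; rewrite ab (disjointFl d bB) in aA.
Qed.

Lemma card_edges_between H A B : [disjoint A & B] ->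
  #|edges_between (adj H) A B| = #|edges H :&: crossing A B|.
Proof.
move=> d; rewrite -(card_in_imset (f := fun q : 'I_n * 'I_n => [set q.1; q.2]));
  last first.
  move=> q q'; rewrite !inE => /and3P[h1 h2 _] /and3P[h3 h4 _].
  by apply: (crossing_inj d); rewrite inE ?h1 ?h2 ?h3 ?h4.
apply: eq_card => e; rewrite inE; apply/imsetP/andP.
  case=> q; rewrite inE => /and3P[h1 h2 h3] ->; split=> //.
  by apply/imsetP; exists q; rewrite // inE h1 h2.
case=> eH /imsetP[q]; rewrite inE => /andP[h1 h2] ee; exists q => //.
by rewrite inE h1 h2 /adj -ee eH.
Qed.

(** A crossing pair contributes 1 - p (1 - 1 / e) <= 1 - p / 2 <= e^(-p / 2), by e >= 2; every other
    pair contributes 1. *)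
Lemma mean_expR_crossing A B : [disjoint A & B] ->
  \sum_(H : sgraph 'I_n) gnp_mass p H * expR (- #|edges_between (adj H) A B|%:R)
    <= expR (- (p / 2) * (#|A| * #|B|)%:R).
Proof.
move=> d; have [p0 p1] := andP p01; have [e2 e4] := andP expR1_bounds.
have em : expR (-1) <= 2^-1 :> R by rewrite expRN lef_pV2 ?posrE ?expR_gt0.
have em0 := expR_gt0 (-1 : R).
rewrite (eq_bigr (fun H => gnp_mass p H *
    \prod_(e in edges H) (if e \in crossing A B then expR (-1) else 1))); last first.
  move=> H _; congr (_ * _); rewrite card_edges_between // -big_mkcondr /=.
  rewrite (eq_bigl (mem (edges H :&: crossing A B))) => [|e]; last by rewrite !inE.
  by rewrite prodr_const -expRM_natr mulN1r.
rewrite gnp_mean_prod (bigID (mem (crossing A B))) /= [X in _ * X]big1 ?mulr1;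
  last first.
  by move=> e /andP[_ /negbTE ->]; rewrite mulr1 subrK.
rewrite (eq_bigl (mem (crossing A B))); last first.
  by move=> e /=; have [/(crossing_pair d) ->|] := boolP (e \in crossing A B);
    rewrite ?andbF.
apply: le_trans (_ : \prod_(e in crossing A B) expR (- (p / 2)) <= _).
  apply: ler_prod => e ee; rewrite (ee : e \in crossing A B); apply/andP; split;
    first by nra.
  apply: le_trans (expR_ge1Dx _); nra.
by rewrite prodr_const -expRM_natr card_crossing.
Qed.

Lemma spread_of_counts H N : (0 < N)%N ->
  #|edges H|%:R <= 4 * p * (n * n)%:R ->
  (forall A B, [disjoint A & B] -> (n <= N * #|A|)%N -> (n <= N * #|B|)%N ->
     p * (n * n)%:R / (8 * (N * N)%:R) < #|edges_between (adj H) A B|%:R) ->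
  spread (adj H) N (32 * (N * N)).
Proof.
move=> N_gt0 hE hAB A B d; rewrite card_ord => hA hB; have hab := hAB A B d hA hB.
have NN : 0 < (N * N)%:R :> R by rewrite ltr0n muln_gt0 N_gt0.
have p0 : 0 <= p * (n * n)%:R by rewrite mulr_ge0 ?ler0n //; case/andP: p01.
split; first by rewrite -(ltr0n R); apply: le_lt_trans hab;
  rewrite divr_ge0 // mulr_ge0 ?ltW.
move=> A' B' d'; rewrite card_edges_between //.
apply: leq_trans (subset_leq_card (finset.subsetIl _ _)) _.
rewrite -(ler_nat R); apply: le_trans hE _.
move: hab; rewrite ltr_pdivrMr ?mulr_gt0 // !natrM => hab; lra.
Qed.

(* Used with x = |A| |B|, M = N^2, m = n and the threshold t = p n^2 / (8 N^2). *)
Lemma crossing_exponent (x M t m : R) : m * m <= M * x -> 8 * M <= p * m ->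
  t * (8 * M) = p * (m * m) -> 0 < M -> 0 < m -> 0 <= p ->
  - (p / 2) * x + t <= - (3 * m).
Proof.
move=> hx hp e M0 m0 p0.
have h1 : m <= t.
  rewrite -(ler_pM2r (_ : 0 < 8 * M)) ?mulr_gt0 // e; nra.
have h2 : 8 * t <= p * x.
  rewrite -(ler_pM2r M0) (_ : 8 * t * M = p * (m * m)); last by rewrite -e; ring.
  by rewrite -mulrA [x * M]mulrC; apply: ler_wpM2l.
by lra.
Qed.

(** Failure is dominated by a function of small mean instead of being given a probability: such
    functions add over several scales, and Markov's inequality is applied once at the end. *)
Lemma gnp_not_spread N : (0 < N)%N -> (0 < n)%N -> 8 * (N * N)%:R <= p * n%:R ->
  exists f : sgraph 'I_n -> R, [/\ forall H, 0 <= f H,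
    forall H, ~ spread (adj H) N (32 * (N * N)) -> 1 <= f H &
    \sum_(H : sgraph 'I_n) gnp_mass p H * f H <= 2 * expR (- n%:R)].
Proof.
move=> N_gt0 n_gt0 hp.
pose th := p * (n * n)%:R / (8 * (N * N)%:R).
pose big (q : {set 'I_n} * {set 'I_n}) :=
  [&& [disjoint q.1 & q.2], (n <= N * #|q.1|)%N & (n <= N * #|q.2|)%N].
pose f1 (H : sgraph 'I_n) := expR (#|edges H|%:R - 4 * p * (n * n)%:R).
pose f2 (H : sgraph 'I_n) := \sum_(q | big q) expR
  (th - #|edges_between (adj H) q.1 q.2|%:R).
have f2_ge0 H : 0 <= f2 H by apply: sumr_ge0 => q _; apply: expR_ge0.
exists (fun H => f1 H + f2 H); split.
- by move=> H; rewrite addr_ge0 ?expR_ge0.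
- move=> H nS; have [hE|hE] := leP (#|edges H|%:R : R) (4 * p * (n * n)%:R); last first.
    rewrite ler_wpDr // -expR0 ler_expR subr_ge0; exact: ltW.
  rewrite ler_wpDl ?expR_ge0 //; apply: contrapT => /negP; rewrite -ltNge => hf.
  apply: nS; apply: spread_of_counts => // A B d hA hB; rewrite -/th ltNge;
    apply/negP => hth.
  move: hf; rewrite ltNge => /negP; apply.
  have bAB : big (A, B) by rewrite /big /= d hA hB.
  rewrite /f2 (bigD1 (A, B)) //= ler_wpDr ?sumr_ge0 //.
  by rewrite -[leLHS]expR0 ler_expR subr_ge0.
have n0 : 0 < n%:R :> R by rewrite ltr0n.
have NN : 1 <= (N * N)%:R :> R by rewrite ler1n muln_gt0 N_gt0.
rewrite (eq_bigr (fun H => gnp_mass p H * f1 H + gnp_mass p H * f2 H)) => [|H _];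
  last by rewrite mulrDr.
rewrite big_split /= [leRHS](_ : _ = expR (- n%:R) + expR (- n%:R)); last by ring.
apply: lerD.
  rewrite (eq_bigr (fun H => gnp_mass p H * expR #|edges H|%:R * expR
    (- (4 * p * (n * n)%:R)))); last first.
    by move=> H _; rewrite /f1 expRD mulrA.
  rewrite -mulr_suml.
  apply: le_trans (ler_wpM2r (expR_ge0 _) mean_expR_edges) _.
  rewrite -expRD ler_expR natrM; nra.
rewrite (eq_bigr (fun H => \sum_(q | big q) gnp_mass p H * expR
  (- #|edges_between (adj H) q.1 q.2|%:R) * expR th)); last first.
  move=> H _; rewrite /f2 mulr_sumr; apply: eq_bigr => q _.
  by rewrite addrC expRD mulrA.
rewrite exchange_big /=.
(* Each pair of sets has mean at most e^(-3 n), and there are 4^n <= e^(2 n) pairs. *)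
apply: le_trans (_ : \sum_(q : {set 'I_n} * {set 'I_n}) expR (- (3 * n%:R)) <= _).
  rewrite big_mkcond; apply: ler_sum => q _; case: ifP => [/and3P[d hA hB]|_];
    last exact: expR_ge0.
  rewrite -mulr_suml; apply: le_trans (ler_wpM2r (expR_ge0 _) (mean_expR_crossing d)) _.
  rewrite -expRD ler_expR.
  have hAB : (n * n)%:R <= (N * N)%:R * (#|q.1| * #|q.2|)%:R :> R.
    by rewrite -natrM ler_nat mulnACA leq_mul.
  have NN0 : 0 < (N * N)%:R :> R by apply: lt_le_trans NN.
  have e : th * (8 * (N * N)%:R) = p * (n%:R * n%:R).
    by rewrite /th divfK; [rewrite natrM | rewrite gt_eqF ?mulr_gt0].
  rewrite natrM in hAB; exact: crossing_exponent hAB hp e NN0 n0 (proj1 (andP p01)).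
rewrite sumr_const card_prod -cardsT -powersetT card_powerset cardsT card_ord.
rewrite -[_ *+ (_ * _)]mulr_natr natrM natrX.
have h2n : 2 ^+ n <= expR n%:R :> R.
  rewrite -[X in expR X]mulr1 expRM_natl lerXn2r ?nnegrE ?expR_ge0 //.
  by have /andP[] := expR1_bounds.
apply: le_trans (_ : expR (- (3 * n%:R)) * (expR n%:R * expR n%:R) <= _).
  by rewrite ler_wpM2l ?expR_ge0 // ler_pM ?exprn_ge0.
by rewrite -!expRD ler_expR; lra.
Qed.

End Gnp.

Lemma gnp_all_spread (R : realType) (n : nat) (p : R) (Ns : seq nat) :
  0 <= p <= 1 -> (0 < n)%N -> all (leq 1) Ns ->
  {in Ns, forall N, 8 * (N * N)%:R <= p * n%:R} ->
  1 - (2 * size Ns)%:R * expR (- n%:R) <=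
    gnp_pr p (fun H : sgraph 'I_n => `[< all_spread (adj H) Ns >]).
Proof.
move=> p01 n_gt0 Ns1 hp.
suff [f [f0 f1 fm]] : exists f : sgraph 'I_n -> R, [/\ forall H, 0 <= f H,
    forall H, ~ all_spread (adj H) Ns -> 1 <= f H &
    \sum_(H : sgraph 'I_n) gnp_mass p H * f H <= (2 * size Ns)%:R * expR (- n%:R)].
  apply: le_trans (gnp_markov p01 (f := f) f0 _); first by rewrite lerD2l lerN2.
  by move=> H /asboolPn; apply: f1.
elim: Ns Ns1 hp => [|N Ns IH] /=.
  move=> _ _; exists (fun=> 0); split=> // [H []//|].
  by rewrite big1 ?muln0 ?mul0r // => H _; rewrite mulr0.
move=> /andP[N_gt0 Ns1] hp.
have [|f [f0 f1 fm]] := IH Ns1.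
  by move=> N' N'Ns; apply: hp; rewrite inE N'Ns orbT.
have [g [g0 g1 gm]] := gnp_not_spread p01 N_gt0 n_gt0 (hp N (mem_head _ _)).
exists (fun H => g H + f H); split=> [H|H nS|]; first by rewrite addr_ge0.
  have [sN|nN] := pselect (spread (adj H) N (32 * (N * N))); last first.
    by rewrite ler_wpDr // g1.
  rewrite ler_wpDl // f1 // => aS; apply: nS => N'; rewrite inE => /orP[/eqP -> //|].
  exact: aS.
under eq_bigr do rewrite mulrDr.
by rewrite big_split /= mulnS natrD mulrDl lerD.
Qed.

(** The constant adds up the requirements 8 N^2 <= p n of all scales; the summand 1 keeps it
    positive. *)
Lemma whp_of_spread (R : realType) (k n0 : nat) (Ns : seq nat)
  (A : forall n, pred (sgraph 'I_n)) (p : nat -> R) :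
  (0 < k)%N -> all (leq 1) Ns ->
  (forall n (H : sgraph 'I_n), (n0 <= n)%N -> (k %| n)%N ->
     all_spread (adj H) Ns -> A n H) ->
  prob_at_least k (1 + \sum_(N <- Ns) 8 * (N * N)%:R) p ->
  whp_multiples k p A.
Proof.
move=> k_gt0 Ns1 hA [p01 hp]; rewrite /whp_multiples.
pose c : R := (2 * size Ns)%:R.
(* With n = k m, the failure bound c e^(-n) is at most c / (m + 1). *)
apply: (@squeeze_cvgr _ _ _ _ (fun m => 1 - c * harmonic m) (fun=> 1)); last first.
- exact: cvg_cst.
- have h : ((fun m => 1 - c * harmonic m : R) @ \oo --> (1 - c * 0 : R))%classic.
    by apply: cvgB; [exact: cvg_cst | apply: cvgMl_tmp; exact: cvg_harmonic].
  by rewrite mulr0 subr0 in h.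
near=> m; apply/andP; split; last exact: gnp_pr_le1.
have m_gt0 : (0 < m)%N by near: m; exists 1%N.
have n_large : (n0 <= k * m)%N.
  apply: leq_trans (leq_pmull _ k_gt0); near: m; by exists n0.
have km_gt0 : (0 < k * m)%N by rewrite muln_gt0 k_gt0.
have pC : (1 + \sum_(N <- Ns) 8 * (N * N)%:R) / (k * m)%:R <= p (k * m)%N by near: m.
rewrite ler_pdivrMr ?ltr0n // in pC.
apply: le_trans (gnp_pr_mono (p01 _) (P := fun H => `[< all_spread (adj H) Ns >]) _);
  last first.
  by move=> H /asboolP hS; apply: hA => //; apply: dvdn_mulr.
apply: le_trans (gnp_all_spread (p01 _) km_gt0 Ns1 _).
  rewrite lerD2l lerN2 ler_wpM2l ?ler0n // expRN lef_pV2 ?posrE ?expR_gt0 ?ltr0n //.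
  apply: le_trans (expR_ge1Dx _); rewrite -natr1 addrC lerD2l ler_nat.
  exact: leq_pmull.
move=> N NNs; apply: le_trans pC; rewrite (big_rem N) //=.
have : 0 <= \sum_(N <- rem N Ns) 8 * (N * N)%:R :> R by apply: sumr_ge0 => *;
  rewrite mulr_ge0.
lra.
Unshelve. all: by end_near.
Qed.

Theorem corollary1p13 (R : realType) (k : nat) (hk : (4 <= k)%N) :
  (forall eta : R, 0 < eta ->
    exists2 C : R, 0 < C &
      forall T : sgraph 'I_k, is_tree T ->
      forall p : nat -> R, prob_at_least k C p ->
        whp_multiples k p (fun n => @perturbed_factor R k n T eta))
  /\
  (forall eta : R, k%:R^-1 < eta ->
    exists2 C : R, 0 < C &
      forall p : nat -> R, prob_at_least k C p ->
        whp_multiples k p (fun n => @perturbed_factor R k n (cycle_graph k) eta)).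
Proof.
have k_gt0 : (0 < k)%N by apply: leq_trans hk.
have bound (x : R) : 0 < x -> exists2 q, (0 < q)%N & 1 <= q%:R * x.
  move=> x0; have x1 : 0 <= x^-1 by rewrite invr_ge0 ltW.
  have h := archi_boundP x1; exists (Num.bound x^-1).
    by rewrite -(ltr0n R); apply: le_lt_trans h.
  by rewrite -ler_pdivrMr // mul1r ltW.
have C_gt0 (Ns : seq nat) : 0 < 1 + \sum_(N <- Ns) 8 * (N * N)%:R :> R.
  by rewrite ltr_wpDr // sumr_ge0 // => *; rewrite mulr_ge0.
split=> eta eta_gt.
  have [q q_gt0 hq] := bound eta eta_gt.
  (* The scales are fixed before the tree, so one constant serves all trees on k vertices. *)
  have [|Ns [n0 [Ns1 hfac]]] := @tree_factor k q _ q_gt0; first by apply: leq_trans hk.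
  exists (1 + \sum_(N <- Ns) 8 * (N * N)%:R) => // T treeT p hp.
  apply: (whp_of_spread (n0 := n0) k_gt0 Ns1 _ hp) => n H n_large kn hS.
  apply/forallP => G; apply/implyP => hG; apply: (hfac _ _ _ _ n_large kn hS _ treeT).
  rewrite -(ler_nat R) natrM; apply: le_trans (ler_wpM2l (ler0n _ _) hG).
  by rewrite mulrA ler_peMl.
have k0 : 0 < k%:R :> R by rewrite ltr0n.
have [|q q_gt0 hq] := bound (eta - k%:R^-1); first by rewrite subr_gt0.
have [Ns [n0 [Ns1 hfac]]] := cycle_factor hk q_gt0.
exists (1 + \sum_(N <- Ns) 8 * (N * N)%:R) => // p hp.
apply: (whp_of_spread (n0 := n0) k_gt0 Ns1 _ hp) => n H n_large kn hS.
apply/forallP => G; apply/implyP => hG; apply: (hfac _ _ _ n_large kn hS).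
rewrite -(ler_nat R) !natrM natrD.
apply: le_trans (ler_wpM2l _ hG); last by rewrite mulr_ge0.
rewrite mulrA ler_wpM2r //.
(* By q (eta - 1 / k) >= 1, the minimum degree is at least n / k + n / q, as [cycle_factor]
   demands. *)
have -> : k%:R * q%:R * eta = k%:R * (q%:R * (eta - k%:R^-1)) + q%:R.
  by field; rewrite gt_eqF.
by rewrite addrC lerD2r ler_peMr // ltW.
Qed.
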